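(* Let $\psi=0$, so $F=f$, where $f:\mathbb{R}^d\to\mathbb{R}$ is convex and three times differentiable with $M$-Lipschitz continuous Hessian and is $\mu$-strongly convex with $\mu>0$, i.e. $\nabla^2 f(x)\succeq\mu\mathbf{I}^d$ for all $x$. Let $x^*$ be the minimizer of $f$, $F^*=f(x^* )$, $\mathbf{H}_*:=\nabla^2 f(x^* )$, and $$\zeta:=\lambda_{\min}\left(\mathbf{H}_*^{1/2}\,\mathbb{E}\left[\mathbf{S}\left(\mathbf{S}^\top\mathbf{H}_*\mathbf{S}\right)^{-1}\mathbf{S}^\top\right]\mathbf{H}_*^{1/2}\right),\qquad \mathbf{S}\sim\mathcal{D}.$$ Let $\{x^k\}_{k\ge0}$ be generated by SSCN. Then for any $\varepsilon>0$ there exists $\delta>0$ such that if $F(x^0)-F^*\le\delta$, then for all $k\ge0$ $$\mathbb{E}\left[F(x^k)-F^*\right]\le\left(1-(1-\varepsilon)\zeta\right)^k\left(F(x^0)-F^*\right).$$ Therefore the local complexity of SSCN is $\mathcal{O}(\zeta^{-1}\log\frac1\varepsilon)$; that is, if $\zeta>0$, there are a universal constant $C>0$ and some $\delta>0$ such that whenever $F(x^0)-F^*\le\delta$, for every $\epsilon'\in(0,1)$ one has $\mathbb{E}[F(x^k)-F^*]\le\epsilon'(F(x^0)-F^* )$ for all integers $k\ge C\zeta^{-1}\log\frac{1}{\epsilon'}$. If moreover $M=0$ (i.e. $f$ is quadratic), then the displayed bound holds with $\varepsilon=0$ and $\delta=\infty$, i.e. for every starting point $x^0$.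
   Context: $\|\cdot\|$ is the Euclidean norm and $\mathbf{I}^q$ the $q\times q$ identity. $\mathcal{D}$ is a fixed distribution of random matrices $\mathbf{S}\in\mathbb{R}^{d\times\tau(\mathbf{S})}$ (the number of columns $\tau(\mathbf{S})$ may be random) having full column rank with probability one. Subspace quantities: $\nabla_{\mathbf{S}}f(x):=\mathbf{S}^\top\nabla f(x)$, $\nabla^2_{\mathbf{S}}f(x):=\mathbf{S}^\top\nabla^2 f(x)\mathbf{S}$, and $$M_{\mathbf{S}}:=\max_{x\in\mathbb{R}^d}\max_{h\in\mathbb{R}^{\tau(\mathbf{S})},\,h\ne0}\frac{|\nabla^3 f(x)[\mathbf{S}h]^3|}{\|\mathbf{S}h\|^3}.$$ Algorithm SSCN (Stochastic Subspace Cubic Newton), in the case $\psi=0$: start from $x^0\in\mathbb{R}^d$; for $k=0,1,\dots$ sample $\mathbf{S}\sim\mathcal{D}$ independently of the past, let $h^k=\arg\min_{h\in\mathbb{R}^{\tau(\mathbf{S})}}\left\{\langle\nabla_{\mathbf{S}}f(x^k),h\rangle+\tfrac12\langle\nabla^2_{\mathbf{S}}f(x^k)h,h\rangle+\tfrac{M_{\mathbf{S}}}{6}\|\mathbf{S}h\|^3\right\}$, and set $x^{k+1}=x^k+\mathbf{S}h^k$. *)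

(* Defs.v *)
From HB Require Import structures.
From mathcomp Require Import all_boot all_order all_algebra.
From mathcomp Require Import all_classical all_reals all_analysis.

Set Implicit Arguments.
Unset Strict Implicit.
Unset Printing Implicit Defensive.

Import Order.TTheory GRing.Theory Num.Theory.
Import numFieldNormedType.Exports.

Local Open Scope classical_set_scope.
Local Open Scope ring_scope.

Section Euclidean.
Context {R : realType}.

Definition dotv n (u v : 'cV[R]_n) : R := (u^T *m v) 0 0.

(* The norm that the library puts on matrices is the sup norm, hence this
   separate Euclidean norm.  The two induce the same topology, so the library's
   [differentiable] is the usual Frechet differentiability. *)
Definition enorm n (u : 'cV[R]_n) : R := Num.sqrt (dotv u u).

Definition opnorm n (A : 'M[R]_n) : R :=
  sup [set enorm (A *m h) | h in [set h : 'cV[R]_n | enorm h <= 1]].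

Definition psd n (A : 'M[R]_n) : Prop :=
  A^T = A /\ forall h : 'cV[R]_n, 0 <= dotv (A *m h) h.

Definition loewner_ge n (A B : 'M[R]_n) : Prop := psd (A - B).

(* A^{1/2}: the unique positive semidefinite B with B * B = A (it exists when A
   is positive semidefinite; the default value 0 is for other A). *)
Definition psd_sqrt n (A : 'M[R]_n) : 'M[R]_n :=
  xget 0 [set B : 'M[R]_n | psd B /\ B *m B = A].

Definition lambda_min n (A : 'M[R]_n) : R := inf [set a : R | eigenvalue A a].

End Euclidean.

Section Derivatives.
Context {R : realType} {d : nat}.
Implicit Types (f : 'cV[R]_d -> R) (x h : 'cV[R]_d).

Definition basis_vec (i : 'I_d) : 'cV[R]_d := delta_mx i 0.

Definition grad f x : 'cV[R]_d := \col_i 'D_(basis_vec i) f x.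

Definition hess f x : 'M[R]_d :=
  \matrix_(i, j) 'D_(basis_vec j) (fun y => grad f y i 0) x.

Definition thrice_differentiable f : Prop :=
  forall x, [/\ differentiable f x, differentiable (grad f) x
              & differentiable (hess f) x].

(* nabla^3 f(x)[h]^3 *)
Definition third_dir f x h : R := 'D_h ('D_h ('D_h f)) x.

Definition lipschitz_hess (M : R) f : Prop :=
  forall x y, opnorm (hess f x - hess f y) <= M * enorm (x - y).

Definition strongly_convex (mu : R) f : Prop :=
  forall x, loewner_ge (hess f x) mu%:M.

Definition minimizer f x : Prop := forall y, f x <= f y.

End Derivatives.

Section Step.
Context {R : realType} {d t : nat}.
Implicit Types (f : 'cV[R]_d -> R) (S : 'M[R]_(d, t)) (x : 'cV[R]_d).

Definition sgrad f S x : 'cV[R]_t := S^T *m grad f x.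

Definition shess f S x : 'M[R]_t := S^T *m hess f x *m S.

Definition MS f S : R :=
  sup [set r | exists (x : 'cV[R]_d) (h : 'cV[R]_t), h != 0 /\
         r = `|third_dir f x (S *m h)| / enorm (S *m h) ^+ 3].

Definition cubic_model f S x (h : 'cV[R]_t) : R :=
  dotv (sgrad f S x) h + 2^-1 * dotv (shess f S x *m h) h
  + MS f S / 6 * enorm (S *m h) ^+ 3.

Definition is_argmin (g : 'cV[R]_t -> R) (h : 'cV[R]_t) : Prop :=
  forall h', g h <= g h'.

Definition sscn_step f S x (y : 'cV[R]_d) : Prop :=
  exists2 h : 'cV[R]_t, is_argmin (cubic_model f S x) h & y = x + S *m h.

End Step.

(* Matrices with d rows and an arbitrary number of columns, [tag S] being the
   number of columns tau(S) and [tagged S] the matrix itself. *)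
Definition skmx (R : realType) (d : nat) : Type := {t : nat & 'M[R]_(d, t)}.

HB.instance Definition _ (R : realType) (d : nat) := Choice.on (skmx R d).
HB.instance Definition _ (R : realType) (d : nat) :=
  isPointed.Build (skmx R d) (Tagged (fun t => 'M[R]_(d, t)) (0 : 'M[R]_(d, 0))).

(* The disjoint union, over the number t of columns, of the Borel
   sigma-algebras of R^(d x t). *)
Definition skmx_gen (R : realType) (d : nat) : set (set (skmx R d)) :=
  [set E | exists t : nat, E = [set S : skmx R d | tag S = t]] `|`
  [set E | exists (t : nat) (i : 'I_d) (j : 'I_t) (B : set R), measurable B /\
     E = [set S : skmx R d | exists2 A : 'M[R]_(d, t),
            S = Tagged (fun t => 'M[R]_(d, t)) A & B (A i j)]].

Notation sketch R d := (g_sigma_algebraType (@skmx_gen R d)).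

Section Sketch.
Context {R : realType} {d : nat}.

Definition full_col_rank (S : sketch R d) : Prop := \rank (tagged S) = tag S.

Definition proj_term (H : 'M[R]_d) (S : sketch R d) : 'M[R]_d :=
  tagged S *m invmx ((tagged S)^T *m H *m tagged S) *m (tagged S)^T.

Definition Eproj (D : probability (sketch R d) R) (H : 'M[R]_d) : 'M[R]_d :=
  \matrix_(i, j) fine ('E_D[fun S => proj_term H S i j])%E.

Definition zeta (D : probability (sketch R d) R) (H : 'M[R]_d) : R :=
  lambda_min (psd_sqrt H *m Eproj D H *m psd_sqrt H).

End Sketch.

Section Process.
Context {R : realType} {d : nat} {dO : measure_display}
  {Omega : measurableType dO}.
Implicit Types (S : nat -> Omega -> sketch R d) (x : nat -> Omega -> 'cV[R]_d).

(* The sigma-algebra generated by x^0, ..., x^k and by the matrices sampled in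
   the iterations before the k-th one. *)
Definition past S x (k : nat) : set (set Omega) :=
  <<s [set E | exists (i : nat) (j : 'I_d) (B : set R),
         [/\ (i <= k)%N, measurable B & E = [set w | B (x i w j 0)]]] `|`
      [set E | exists (i : nat) (B : set (sketch R d)),
         [/\ (i < k)%N, measurable B & E = S i @^-1` B]] >>.

Record is_sscn (f : 'cV[R]_d -> R) (D : probability (sketch R d) R)
    (x0 : 'cV[R]_d) (P : probability Omega R) S x : Prop := IsSSCN {
  sscn_start : forall w, x 0%N w = x0;
  sscn_sample_meas : forall k, measurable_fun [set: Omega] (S k);
  sscn_iter_meas : forall k (j : 'I_d),
    measurable_fun [set: Omega] (fun w => x k w j 0);
  sscn_law : forall k (B : set (sketch R d)),
    measurable B -> P (S k @^-1` B) = D B;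
  sscn_indep : forall k (A : set Omega) (B : set (sketch R d)),
    past S x k A -> measurable B ->
    (P (A `&` S k @^-1` B) = P A * P (S k @^-1` B))%E;
  (* Almost surely only, since the arg min need not exist when the sampled
     matrix does not have full column rank. *)
  sscn_iter : forall k, {ae P, forall w,
    sscn_step f (tagged (S k w)) (x k w) (x k.+1 w)}
}.

End Process.

(* Main.v *)
Require Import Defs.
From HB Require Import structures.
From mathcomp Require Import all_boot all_order all_algebra.
From mathcomp Require Import all_classical all_reals all_analysis.
From mathcomp Require Import measurable_realfun.
From mathcomp Require Import ring lra.

Set Implicit Arguments.
Unset Strict Implicit.
Unset Printing Implicit Defensive.

Import Order.TTheory GRing.Theory Num.Theory.
Import numFieldNormedType.Exports.

Local Open Scope classical_set_scope.
Local Open Scope ring_scope.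

(* Write g for the gradient at the current point, H for the Hessian at the
   minimizer, and Pi = S (S^T H S)^-1 S^T, so that Pi H Pi = Pi.  The cubic model
   is an upper bound on f because |D^3 f(x)[Sh]^3| <= M_S |Sh|^3.  Its minimum is
   at most its value at h = - (S^T H S)^-1 S^T g, and near the minimizer this
   value is at most -(a/2) g^T Pi g with a close to 1.  Strong convexity gives in
   the same way b (f x - min f) <= (1/2) g^T H^-1 g with b close to 1.  S is
   independent of the past, so in the mean Pi may be replaced by E[Pi], and
   g^T E[Pi] g >= zeta g^T H^-1 g by the variational characterization of the
   least eigenvalue.  Steps never increase f, hence the iterates stay in the
   sublevel set where these estimates hold.  If M = 0 the Hessian is constant and
   a = b = 1 everywhere. *)

(** * Euclidean norm and symmetric matrices *)

(** The trial step is built from the Hessian at the minimizer, which the algorithm never sees, and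
    not from the one at the current point. This makes Pi a function of the sample alone: g^T Pi g is
    a finite sum of products of a function of the iterate and a function of the sample, and its mean
    factorizes by independence of two real random variables, without conditional expectations. The
    price is an error M |x - xs| / mu of the Hessian relative to H. The cubic term is also a small
    multiple of g^T Pi g, so that both errors fit into the factor a, while b carries the Hessian
    error only. Integrability needs no moments of S: the entries of Pi are at most 1 / mu, and the
    gradient is bounded on sublevel sets, which strong convexity makes bounded. *)

Section DotProduct.
Context {R : realType}.
Implicit Types n m : nat.

Lemma dotvE n (u v : 'cV[R]_n) : dotv u v = \sum_i u i 0 * v i 0.
Proof. by rewrite /dotv mxE; apply: eq_bigr => i _; rewrite mxE. Qed.

Lemma dotvC n (u v : 'cV[R]_n) : dotv u v = dotv v u.
Proof. by rewrite !dotvE; apply: eq_bigr => i _; rewrite mulrC. Qed.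

Lemma dotvDl n (u v w : 'cV[R]_n) : dotv (u + v) w = dotv u w + dotv v w.
Proof. by rewrite /dotv linearD mulmxDl mxE. Qed.

Lemma dotvDr n (u v w : 'cV[R]_n) : dotv u (v + w) = dotv u v + dotv u w.
Proof. by rewrite !(dotvC u) dotvDl. Qed.

Lemma dotvZl n a (u v : 'cV[R]_n) : dotv (a *: u) v = a * dotv u v.
Proof. by rewrite /dotv linearZ -scalemxAl mxE. Qed.

Lemma dotvZr n a (u v : 'cV[R]_n) : dotv u (a *: v) = a * dotv u v.
Proof. by rewrite dotvC dotvZl dotvC. Qed.

Lemma dotvNl n (u v : 'cV[R]_n) : dotv (- u) v = - dotv u v.
Proof. by rewrite -scaleN1r dotvZl mulN1r. Qed.

Lemma dotvNr n (u v : 'cV[R]_n) : dotv u (- v) = - dotv u v.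
Proof. by rewrite dotvC dotvNl dotvC. Qed.

Lemma dotv0l n (u : 'cV[R]_n) : dotv 0 u = 0.
Proof. by rewrite -(scale0r u) dotvZl mul0r. Qed.

Lemma dotv_adjoint m n (A : 'M[R]_(m, n)) u v : dotv (A *m u) v = dotv u (A^T *m v).
Proof. by rewrite /dotv trmx_mul mulmxA. Qed.

Lemma dotv_sym n (A : 'M[R]_n) u v : A^T = A -> dotv (A *m u) v = dotv u (A *m v).
Proof. by move=> As; rewrite dotv_adjoint As. Qed.

Lemma dotv_ge0 n (u : 'cV[R]_n) : 0 <= dotv u u.
Proof. by rewrite dotvE sumr_ge0// => i _; rewrite -expr2 sqr_ge0. Qed.

Lemma dotv_eq0 n (u : 'cV[R]_n) : (dotv u u == 0) = (u == 0).
Proof.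
apply/eqP/eqP => [|->]; last by rewrite dotv0l.
rewrite dotvE => /eqP; rewrite psumr_eq0 => [/allP u0|i _]; last first.
  by rewrite -expr2 sqr_ge0.
apply/matrixP => i j; rewrite ord1 mxE.
by have := u0 i (mem_index_enum _); rewrite mulf_eq0 orbb => /eqP.
Qed.

Lemma dotv_gt0 n (u : 'cV[R]_n) : (0 < dotv u u) = (u != 0).
Proof. by rewrite lt0r dotv_ge0 andbT dotv_eq0. Qed.

Lemma enorm_ge0 n (u : 'cV[R]_n) : 0 <= enorm u.
Proof. exact: sqrtr_ge0. Qed.

Lemma enorm_sqr n (u : 'cV[R]_n) : enorm u ^+ 2 = dotv u u.
Proof. by rewrite sqr_sqrtr// dotv_ge0. Qed.

Lemma enorm0 n : enorm (0 : 'cV[R]_n) = 0.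
Proof. by rewrite /enorm dotv0l sqrtr0. Qed.

Lemma enorm_eq0 n (u : 'cV[R]_n) : (enorm u == 0) = (u == 0).
Proof. by rewrite -dotv_eq0 -enorm_sqr sqrf_eq0. Qed.

Lemma enormZ n a (u : 'cV[R]_n) : enorm (a *: u) = `|a| * enorm u.
Proof.
by rewrite /enorm dotvZl dotvZr mulrA -expr2 sqrtrM ?sqr_ge0// sqrtr_sqr.
Qed.

Lemma enormN n (u : 'cV[R]_n) : enorm (- u) = enorm u.
Proof. by rewrite -scaleN1r enormZ normrN1 mul1r. Qed.

(** The form is nonnegative on the span of [u] and [v]. Being only semidefinite, it may vanish at
    [v]; it is then affine along [v], which forces the mixed term to be 0. *)
Lemma psd_cauchy_schwarz n (A : 'M[R]_n) u v : psd A ->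
  dotv (A *m u) v ^+ 2 <= dotv (A *m u) u * dotv (A *m v) v.
Proof.
move=> [As A0].
set a := dotv (A *m u) u; set b := dotv (A *m u) v; set c := dotv (A *m v) v.
have q t s : 0 <= t ^+ 2 * a + 2 * (t * s) * b + s ^+ 2 * c.
  have := A0 (t *: u + s *: v); rewrite mulmxDr -!scalemxAr.
  rewrite !(dotvDl, dotvDr, dotvZl, dotvZr) -/a -/b -/c.
  by rewrite (dotv_sym v u As) (dotvC v) -/b; congr (0 <= _); ring.
have c0 : 0 <= c by exact: A0.
have [c0'|c0'] := eqVneq c 0; last first.
  have cp : 0 < c by rewrite lt0r c0' c0.
  have := q c (- b).
  rewrite (_ : _ + _ = c * (a * c - b ^+ 2)); last by ring.
  by rewrite pmulr_rge0// subr_ge0.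
rewrite c0' mulr0.
have [->|b0] := eqVneq b 0; first by rewrite expr0n.
(* For nonzero [b] this choice would give the form the value -1. *)
have := q 1 (- (a + 1) / (2 * b)); rewrite c0' mulr0 addr0 expr1n mul1r mul1r.
have -> : a + 2 * (- (a + 1) / (2 * b)) * b = -1.
  by field; rewrite b0.
by rewrite ler0N1.
Qed.

Lemma psd1 n : psd (1%:M : 'M[R]_n).
Proof. by split=> [|h]; rewrite ?trmx1// mul1mx dotv_ge0. Qed.

Lemma cauchy_schwarz n (u v : 'cV[R]_n) : `|dotv u v| <= enorm u * enorm v.
Proof.
rewrite -ler_sqr ?nnegrE ?mulr_ge0 ?enorm_ge0// exprMn !enorm_sqr real_normK ?num_real//.
by have := psd_cauchy_schwarz u v (psd1 n); rewrite !mul1mx.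
Qed.

(** Cauchy-Schwarz for the form of [A] at [v] and [A *m v]. *)
Lemma psd_ker n (A : 'M[R]_n) v : psd A -> dotv (A *m v) v = 0 -> A *m v = 0.
Proof.
move=> Ap Av0; apply/eqP; rewrite -dotv_eq0 -sqrf_eq0 eq_le sqr_ge0 andbT.
by have := psd_cauchy_schwarz v (A *m v) Ap; rewrite Av0 mul0r.
Qed.

Lemma coord_le_enorm n (u : 'cV[R]_n) i : `|u i 0| <= enorm u.
Proof.
rewrite -ler_sqr ?nnegrE ?enorm_ge0// enorm_sqr real_normK ?num_real// dotvE.
rewrite (bigD1 i)//= -expr2 lerDl sumr_ge0// => j _.
by rewrite -expr2 sqr_ge0.
Qed.

(** Rules out the default value of [sup]. Coordinates in the unit ball are at most 1 in absolute
    value, so absolute row sums give a bound. *)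
Lemma opnorm_has_sup n (A : 'M[R]_n) :
  has_sup [set enorm (A *m h) | h in [set h : 'cV[R]_n | enorm h <= 1]].
Proof.
split; first by exists (enorm (A *m 0)), 0 => //=; rewrite enorm0.
exists (Num.sqrt (\sum_i (\sum_j `|A i j|) ^+ 2)) => _ [h /= h1 <-].
rewrite ler_wsqrtr// dotvE ler_sum// => i _.
rewrite -expr2 -[leLHS]real_normK ?num_real//.
rewrite ler_sqr ?nnegrE ?sumr_ge0// mxE.
apply: (le_trans (ler_norm_sum _ _ _)); apply: ler_sum => j _.
by rewrite normrM ler_piMr// (le_trans (coord_le_enorm _ _)).
Qed.

Lemma enorm_mulmx_le n (A : 'M[R]_n) h : enorm (A *m h) <= opnorm A * enorm h.
Proof.
have [->|h0] := eqVneq h 0; first by rewrite mulmx0 enorm0 mulr0.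
have hp : 0 < enorm h by rewrite lt0r enorm_eq0 h0 enorm_ge0.
rewrite -ler_pdivrMr//.
apply: sup_ubound; first by have [] := opnorm_has_sup A.
exists ((enorm h)^-1 *: h) => /=.
  by rewrite enormZ ger0_norm ?invr_ge0 ?enorm_ge0// mulVf// gt_eqF.
by rewrite -scalemxAr enormZ ger0_norm ?invr_ge0 ?enorm_ge0// mulrC.
Qed.

Lemma opnorm_ge0 n (A : 'M[R]_n) : 0 <= opnorm A.
Proof.
apply: sup_ubound; first by have [] := opnorm_has_sup A.
by exists 0; rewrite /= ?mulmx0 enorm0.
Qed.

Lemma dotv_mulmx_le n (A : 'M[R]_n) u v :
  `|dotv (A *m u) v| <= opnorm A * enorm u * enorm v.
Proof.
apply: (le_trans (cauchy_schwarz _ _)).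
by rewrite ler_wpM2r ?enorm_ge0 ?enorm_mulmx_le.
Qed.

End DotProduct.

(** * Least eigenvalue and positive semidefinite square root *)

Section Spectral.
Context {R : realType}.

Lemma mulmx_ext m n (A B : 'M[R]_(m, n)) :
  (forall u : 'cV[R]_n, A *m u = B *m u) -> A = B.
Proof.
move=> AB; apply/matrixP => i j.
have /matrixP/(_ i 0) := AB (delta_mx j 0).
by rewrite -!colE !mxE.
Qed.

Lemma quad_continuous n (B : 'M[R]_n) :
  continuous (fun v : 'rV[R]_n => dotv (B *m v^T) v^T).
Proof.
have -> : (fun v : 'rV[R]_n => dotv (B *m v^T) v^T) =
    (fun v => \sum_i (\sum_j B i j * v 0 j) * v 0 i).
  apply/funext => v; rewrite dotvE; apply: eq_bigr => i _; rewrite !mxE.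
  by congr (_ * _); apply: eq_bigr => j _; rewrite mxE.
apply: continuous_big => [|i _ v]; first exact: add_continuous.
apply: continuousM; last exact: coord_continuous.
apply: continuous_big => [|j _ {}v]; first exact: add_continuous.
by apply: continuousM; [exact: cst_continuous|exact: coord_continuous].
Qed.

Lemma unit_sphere_compact n : compact [set v : 'rV[R]_n | dotv v^T v^T = 1].
Proof.
apply: bounded_closed_compact.
  exists 1; split=> // M M1 v /= v1; apply: (le_trans _ (ltW M1)).
  rewrite /Num.Def.normr/= mx_normrE; apply: bigmax_le => // -[i j] _ /=.
  rewrite ord1 -[v]trmxK mxE; apply: (le_trans (coord_le_enorm _ _)).
  by rewrite /enorm v1 sqrtr1.
have -> : [set v : 'rV[R]_n | dotv v^T v^T = 1] =
    (fun v : 'rV[R]_n => dotv (1%:M *m v^T) v^T) @^-1` [set 1].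
  by apply/seteqP; split=> v /=; rewrite mul1mx.
apply: closed_comp; first by move=> v _; exact: quad_continuous.
exact: closed_eq.
Qed.

(* The Rayleigh quotient attains its minimum on the unit sphere; the minimizer
   is an eigenvector because B - m I is positive semidefinite and its form
   vanishes there. *)
Lemma rayleigh_min n (B : 'M[R]_n) : (0 < n)%N -> B^T = B ->
  exists m (v : 'cV[R]_n), [/\ dotv v v = 1, B *m v = m *: v &
    forall u, m * dotv u u <= dotv (B *m u) u].
Proof.
case: n B => // n B _ Bs.
have S0 : [set v : 'rV[R]_n.+1 | dotv v^T v^T = 1] !=set0.
  exists (delta_mx 0 0); rewrite /= dotvE (bigD1 0)//= big1 ?addr0 => [|i i0].
    by rewrite !mxE !eqxx mul1r.
  by rewrite !mxE (negbTE i0) andbF mul0r.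
have [v0] := EVT_min_rV S0 (@unit_sphere_compact _)
  (continuous_subspaceT (@quad_continuous _ B)).
rewrite inE /= => v01 vmin.
set v := v0^T in v01; set m := dotv (B *m v) v.
have Rm u : m * dotv u u <= dotv (B *m u) u.
  have [->|u0] := eqVneq u 0; first by rewrite mulmx0 !dotv0l mulr0.
  have up : 0 < enorm u by rewrite lt0r enorm_eq0 u0 enorm_ge0.
  have := vmin ((enorm u)^-1 *: u^T); rewrite inE /= linearZ /= trmxK => vm.
  rewrite -enorm_sqr -ler_pdivlMr ?exprn_gt0//.
  apply: (le_trans (vm _)).
    by rewrite dotvZl dotvZr mulrA -expr2 -enorm_sqr -exprMn mulVf ?expr1n ?gt_eqF.
  by rewrite -scalemxAr dotvZl dotvZr mulrA -expr2 exprVn mulrC.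
exists m, v; split=> //.
have Cp : psd (B - m%:M).
  split=> [|h]; first by rewrite linearB /= tr_scalar_mx Bs.
  by rewrite mulmxBl mul_scalar_mx dotvDl dotvNl dotvZl subr_ge0.
have : dotv ((B - m%:M) *m v) v = 0.
  by rewrite mulmxBl mul_scalar_mx dotvDl dotvNl dotvZl v01 mulr1 subrr.
by move/(psd_ker Cp)/eqP; rewrite mulmxBl mul_scalar_mx subr_eq0 => /eqP.
Qed.

Lemma eigenvalue_sym n (B : 'M[R]_n) a : B^T = B -> eigenvalue B a ->
  exists2 v : 'cV[R]_n, v != 0 & B *m v = a *: v.
Proof.
move=> Bs /eigenvalueP[v vB v0]; exists v^T; first by rewrite trmx_eq0.
by rewrite -{1}Bs -trmx_mul vB linearZ.
Qed.

Lemma lambda_min_le n (B : 'M[R]_n) u : B^T = B ->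
  lambda_min B * dotv u u <= dotv (B *m u) u.
Proof.
move=> Bs; have [n0|n0] := posnP n.
  by subst n; rewrite (flatmx0 u) mulmx0 !dotv0l mulr0.
have [m [v [v1 Bv mle]]] := rayleigh_min n0 Bs.
apply: (le_trans _ (mle u)); rewrite ler_wpM2r ?dotv_ge0//.
(* The Rayleigh minimum [m] is an eigenvalue and bounds all others from below, so this [inf] is a
   genuine infimum. *)
apply: ge_inf; last first.
  rewrite /=; apply/eigenvalueP; exists v^T.
    by rewrite -{1}Bs -trmx_mul Bv linearZ.
  by rewrite trmx_eq0 -dotv_eq0 v1 oner_eq0.
exists m => a /= /(eigenvalue_sym Bs)[w w0 Bw].
by have := mle w; rewrite Bw dotvZl ler_pM2r// dotv_gt0.
Qed.

Lemma lambda_min_ge0 n (B : 'M[R]_n) : psd B -> 0 <= lambda_min B.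
Proof.
move=> [Bs B0]; rewrite /lambda_min.
(* [inf] of the empty set is 0. *)
have [->|/set0P ne] := eqVneq [set a | eigenvalue B a] set0; first by rewrite inf0.
apply: lb_le_inf => // a /= /(eigenvalue_sym Bs)[w w0 Bw].
by have := B0 w; rewrite Bw dotvZl pmulr_lge0// dotv_gt0.
Qed.

(** Deflation, by induction on the rank: remove the part of [A] along a top eigenvector [v], take a
    root [B'] of the rest, and add back [Num.sqrt l] along [v]. The cross terms vanish because [B']
    sends [v] to 0. *)
Lemma psd_sqrt_exists n (A : 'M[R]_n) : psd A -> exists B, psd B /\ B *m B = A.
Proof.
have [r] := ubnP (\rank A); elim: r A => // r IH A rA Ap.
have [As A0] := Ap.
have [->|An0] := eqVneq A 0.
  exists 0; split; last by rewrite mulmx0.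
  by split=> [|h]; rewrite ?trmx0// mul0mx dotv0l.
have n0 : (0 < n)%N.
  by case: n {IH rA Ap As A0} A An0 => // A; rewrite (flatmx0 A) eqxx.
(* The least eigenvalue of [- A] is minus the largest one of [A]. *)
have NAs : (- A)^T = - A by rewrite linearN /= As.
have [m [v [v1 Av mle]]] := rayleigh_min n0 NAs.
set l := - m.
have {}Av : A *m v = l *: v by rewrite scaleNr -Av mulNmx opprK.
have {}mle u : dotv (A *m u) u <= l * dotv u u.
  by have := mle u; rewrite mulNmx dotvNl mulNr lerNr.
(* Otherwise the form of [A] is at most 0, hence identically 0, and [A] vanishes. *)
have l0 : 0 < l.
  rewrite ltNge; apply/negP => l0; move/eqP: An0; apply.
  apply: mulmx_ext => u; rewrite mul0mx; apply: (psd_ker Ap); apply/eqP.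
  by rewrite eq_le A0 andbT (le_trans (mle u))// mulr_le0_ge0// dotv_ge0.
have vAv u : dotv (A *m u) v = l * dotv u v.
  by rewrite dotv_sym// Av dotvZr.
pose A' := A - l *: (v *m v^T).
have vvE (u : 'cV[R]_n) : v *m v^T *m u = dotv v u *: v.
  by rewrite -mulmxA [v^T *m u]mx11_scalar mul_mx_scalar.
have A'E u : A' *m u = A *m u - (l * dotv v u) *: v.
  by rewrite mulmxBl -scalemxAl vvE scalerA.
have A'p : psd A'.
  split=> [|u]; first by rewrite linearB linearZ /= trmx_mul trmxK As.
  (* The form of [A'] at [u] is that of [A] at the part of [u] orthogonal to [v]. *)
  have := A0 (u - dotv v u *: v).
  rewrite A'E mulmxBr -scalemxAr Av !(dotvDl, dotvDr, dotvNl, dotvNr, dotvZl, dotvZr).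
  rewrite vAv v1 (dotvC u v); set a := dotv (A *m u) u.
  by move/le_trans; apply; rewrite le_eqVlt; apply/orP; left; apply/eqP; ring.
have A'v : A' *m v = 0 by rewrite A'E Av v1 mulr1 subrr.
(* The row space of [A'] lies in that of [A]. Equality would give [A = C *m A'], and then [A] would
   send [v] to 0. *)
have rA' : (\rank A' < r)%N.
  rewrite -ltnS; apply: (leq_trans _ rA); rewrite ltnS.
  have sub : (A' <= A)%MS.
    apply/row_subP => i; apply/submxP.
    exists (delta_mx 0 i - v i 0 *: v^T).
    have vA : v^T *m A = l *: v^T by rewrite -{1}As -trmx_mul Av linearZ.
    rewrite mulmxBl -scalemxAl vA -rowE.
    apply/matrixP => a b; rewrite !mxE big_ord1 !mxE.
    by rewrite !ord1 mulrCA.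
  rewrite ltn_neqAle mxrankS// andbT; apply/negP => /eqP rE.
  have : (A <= A')%MS by rewrite -(mxrank_leqif_sup sub) rE.
  case/submxP => C AC.
  move: Av; rewrite AC -mulmxA A'v mulmx0 => /esym/eqP.
  by rewrite scaler_eq0 gt_eqF//= -dotv_eq0 v1 oner_eq0.
have [B' [B'p BB]] := IH _ rA' A'p; have [B's B'0] := B'p.
have B'v : B' *m v = 0.
  apply/eqP; rewrite -dotv_eq0 (dotv_sym _ _ B's) mulmxA BB A'v.
  by rewrite dotvC dotv0l.
pose B := B' + Num.sqrt l *: (v *m v^T).
have BE u : B *m u = B' *m u + (Num.sqrt l * dotv v u) *: v.
  by rewrite mulmxDl -scalemxAl vvE scalerA.
exists B; split.
  split=> [|u]; first by rewrite linearD linearZ /= trmx_mul trmxK B's.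
  rewrite BE dotvDl dotvZl addr_ge0//.
  by rewrite -mulrA mulr_ge0 ?sqrtr_ge0// -expr2 sqr_ge0.
apply: mulmx_ext => u.
rewrite -mulmxA !BE mulmxDr -scalemxAr B'v scaler0 addr0 mulmxA BB A'E.
rewrite dotvDr dotvZr v1 mulr1 -(dotv_sym _ _ B's) B'v dotv0l add0r.
by rewrite mulrA -expr2 sqr_sqrtr ?ltW// subrK.
Qed.

Lemma psd_sqrtP n (A : 'M[R]_n) : psd A ->
  psd (psd_sqrt A) /\ psd_sqrt A *m psd_sqrt A = A.
Proof.
move=> Ap; have [B hB] := psd_sqrt_exists Ap.
by apply: (@xgetPex _ 0 [set B : 'M[R]_n | psd B /\ B *m B = A]); exists B.
Qed.

End Spectral.

(** * The matrices S (S^T H S)^-1 S^T and the constant zeta *)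

Section Projection.
Context {R : realType}.

Lemma unitmx_inj n (A : 'M[R]_n) :
  (forall v : 'cV[R]_n, A *m v = 0 -> v = 0) -> A \in unitmx.
Proof.
move=> Ainj; rewrite -unitmx_tr -row_free_unit; apply: inj_row_free => v vA.
apply: trmx_inj; rewrite trmx0; apply: Ainj.
by rewrite -[A]trmxK -trmx_mul vA trmx0.
Qed.

Lemma full_rank_inj m n (S : 'M[R]_(m, n)) (v : 'cV[R]_n) :
  \rank S = n -> S *m v = 0 -> v = 0.
Proof.
move=> rS Sv; apply: trmx_inj; rewrite trmx0; apply/eqP.
have fS : row_free S^T by rewrite /row_free mxrank_tr rS.
by rewrite -(mulmx_free_eq0 _ fS) -trmx_mul Sv trmx0.
Qed.

Context {d : nat} {H : 'M[R]_d} {mu : R}.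
Hypotheses (mu0 : 0 < mu) (HC : loewner_ge H mu%:M).

Lemma loewner_sym : H^T = H.
Proof.
have [HCs _] := HC; apply/eqP; rewrite -subr_eq0; apply/eqP.
by move: HCs; rewrite linearB /= tr_scalar_mx => /addIr ->; rewrite subrr.
Qed.

Lemma loewner_quad u : mu * dotv u u <= dotv (H *m u) u.
Proof.
have [_ /(_ u)] := HC.
by rewrite mulmxBl mul_scalar_mx dotvDl dotvNl dotvZl subr_ge0.
Qed.

Lemma loewner_psd : psd H.
Proof.
split=> [|u]; first exact: loewner_sym.
by apply: le_trans (loewner_quad u); rewrite mulr_ge0 ?dotv_ge0// ltW.
Qed.

Lemma loewner_eq0 u : dotv (H *m u) u <= 0 -> u = 0.
Proof.
move=> Hu; apply/eqP; rewrite -dotv_eq0 eq_le dotv_ge0 andbT.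
by rewrite -(pmulr_rle0 _ mu0) (le_trans (loewner_quad u)).
Qed.

Lemma loewner_unit : H \in unitmx.
Proof. by apply: unitmx_inj => v Hv; apply: loewner_eq0; rewrite Hv dotv0l. Qed.

Section FullRank.
Context {t : nat} {S : 'M[R]_(d, t)}.
Hypothesis rS : \rank S = t.

Let A := S^T *m H *m S.
Let P := S *m invmx A *m S^T.

Lemma restricted_unit : A \in unitmx.
Proof.
apply: unitmx_inj => v Av; apply: (full_rank_inj rS); apply: loewner_eq0.
by rewrite (dotvC (H *m _)) dotv_adjoint !mulmxA -/A Av dotvC dotv0l.
Qed.

Lemma projS_sym : P^T = P.
Proof.
rewrite /P trmx_mul trmxK trmx_mul trmx_inv /A !trmx_mul trmxK loewner_sym.
by rewrite !mulmxA.
Qed.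

(** The inner S^T H S cancels one inverse. Hence [P *m H] is idempotent: it is the projection onto
    the columns of [S] that is orthogonal for the form of [H]. *)
Lemma projS_idem : P *m H *m P = P.
Proof.
rewrite /P -!mulmxA; congr (S *m _).
rewrite !(mulmxA S^T) !(mulmxA (S^T *m H)) -/A (mulmxA A).
by rewrite mulmxV ?restricted_unit// mul1mx.
Qed.

Lemma projS_quad g : dotv (P *m g) g = dotv (H *m (P *m g)) (P *m g).
Proof.
by rewrite [RHS]dotvC [RHS]dotv_adjoint projS_sym [RHS]dotvC (mulmxA H) (mulmxA P) (mulmxA P) projS_idem.
Qed.

Lemma projS_quad_ge g : mu * dotv (P *m g) (P *m g) <= dotv (P *m g) g.
Proof. by rewrite projS_quad loewner_quad. Qed.

Lemma projS_quad_ge0 g : 0 <= dotv (P *m g) g.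
Proof.
by apply: le_trans (projS_quad_ge g); rewrite mulr_ge0 ?dotv_ge0// ltW.
Qed.

(** Expand the nonnegative form of [H] at [invmx H *m g - P *m g]: by [projS_quad] the square of
    [P *m g] cancels one of the two mixed terms. *)
Lemma projS_quad_le g : dotv (P *m g) g <= dotv (invmx H *m g) g.
Proof.
have [_ /(_ (invmx H *m g - P *m g))] := loewner_psd.
rewrite mulmxBr (mulmxA H (invmx H)) mulmxV ?loewner_unit// mul1mx.
rewrite !(dotvDl, dotvDr, dotvNl, dotvNr) -projS_quad.
rewrite (dotv_sym _ _ loewner_sym) (mulmxA H (invmx H)) mulmxV ?loewner_unit// mul1mx.
by rewrite (dotvC g (invmx H *m g)) (dotvC g (P *m g)) => ?; lra.
Qed.

Lemma projS_norm g : enorm (P *m g) <= enorm g / mu.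
Proof.
rewrite ler_pdivlMr// mulrC.
have [->|] := eqVneq (enorm (P *m g)) 0; first by rewrite mulr0 enorm_ge0.
move=> n0; have np : 0 < enorm (P *m g) by rewrite lt0r n0 enorm_ge0.
rewrite -(ler_pM2l np) mulrCA -expr2 enorm_sqr.
apply: (le_trans (projS_quad_ge g)); apply: (le_trans (ler_norm _)).
exact: cauchy_schwarz.
Qed.

(** The bound does not depend on [S]; it makes the entries integrable without moment assumptions on
    the distribution. *)
Lemma projS_coord i j : `|P i j| <= mu^-1.
Proof.
have -> : P i j = (P *m (delta_mx j 0 : 'cV[R]_d)) i 0 by rewrite -colE [RHS]mxE.
apply: (le_trans (coord_le_enorm _ _)); apply: (le_trans (projS_norm _)).
rewrite /enorm dotvE (bigD1 j)//= big1 => [|k kj].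
  by rewrite !mxE !eqxx mulr1 addr0 sqrtr1 mul1r.
by rewrite !mxE (negbTE kj) mul0r.
Qed.

End FullRank.

Section Zeta.
Context {Q : 'M[R]_d}.
Hypotheses (Qs : Q^T = Q) (Q0 : forall g, 0 <= dotv (Q *m g) g)
  (Q1 : forall g, dotv (Q *m g) g <= dotv (invmx H *m g) g).
Let W := psd_sqrt H.

Let Wpsd : psd W. Proof. by have [] := psd_sqrtP loewner_psd. Qed.
Let WW : W *m W = H. Proof. by have [] := psd_sqrtP loewner_psd. Qed.
Let Ws : W^T = W. Proof. by have [] := Wpsd. Qed.

Let Wunit : W \in unitmx.
Proof.
by apply: unitmx_inj => v Wv; apply: loewner_eq0; rewrite -WW -mulmxA Wv mulmx0 dotv0l.
Qed.

Let WQWs : (W *m Q *m W)^T = W *m Q *m W.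
Proof. by rewrite !trmx_mul Ws Qs mulmxA. Qed.

Let WQW v : dotv (W *m Q *m W *m v) v = dotv (Q *m (W *m v)) (W *m v).
Proof. by rewrite -!mulmxA (dotv_sym _ _ Ws). Qed.

Let invW g : dotv (invmx W *m g) (invmx W *m g) = dotv (invmx H *m g) g.
Proof.
have Ws' : (invmx W)^T = invmx W by rewrite trmx_inv Ws.
have WWV : invmx W *m invmx W = invmx H.
  rewrite -[LHS]mul1mx -(mulVmx loewner_unit) -mulmxA -{2}WW -(mulmxA W).
  by rewrite (mulmxA W (invmx W)) !mulmxV// mul1mx mulmxV// mulmx1.
by rewrite -(dotv_sym _ _ Ws') mulmxA WWV.
Qed.

(** The eigenvalue bound for [W *m Q *m W] at [invmx W *m g], whose squared norm is given by
    [invW]. *)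
Lemma zeta_quad_le g :
  lambda_min (W *m Q *m W) * dotv (invmx H *m g) g <= dotv (Q *m g) g.
Proof.
rewrite -invW; apply: (le_trans (lambda_min_le _ WQWs)).
by rewrite WQW (mulmxA W (invmx W)) mulmxV// mul1mx.
Qed.

Lemma zeta_ge0 : 0 <= lambda_min (W *m Q *m W).
Proof. by apply: lambda_min_ge0; split=> // h; rewrite WQW. Qed.

(** Keeps the contraction factor nonnegative, so that the bound for one step can be iterated. *)
Lemma zeta_le1 : (0 < d)%N -> lambda_min (W *m Q *m W) <= 1.
Proof.
move=> d0; pose g := W *m (delta_mx (Ordinal d0) 0 : 'cV[R]_d).
have gp : 0 < dotv (invmx H *m g) g.
  rewrite -invW dotv_gt0 /g mulmxA mulVmx// mul1mx.
  apply/eqP => /matrixP/(_ (Ordinal d0) 0); rewrite !mxE !eqxx => /eqP.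
  by rewrite oner_eq0.
rewrite -(ler_pM2r gp) mul1r.
exact: (le_trans (zeta_quad_le g)).
Qed.

End Zeta.
End Projection.

(** * Taylor estimates and descent of one step *)

Section OneVariable.
Context {R : realType}.

Lemma le_of_derive_ge0 (F F' : R -> R) s :
  (forall r : R, is_derive r 1 F (F' r)) -> (forall r, 0 <= r <= s -> 0 <= F' r) ->
  0 <= s -> F 0 <= F s.
Proof.
move=> dF F'0 s0.
have cF : {within `[0, s], continuous F}.
  apply: derivable_within_continuous => r _.
  by have [] := dF r.
have [c] := MVT_segment s0 (fun x _ => dF x) cF.
rewrite in_itv /= subr0 => cs E.
by rewrite -subr_ge0 E mulr_ge0// F'0.
Qed.

(** The bound on [F2] is integrated twice by monotonicity: each time the majorizing polynomial minus
    the function has a nonnegative derivative. *)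
Lemma taylor2_le (F F1 F2 : R -> R) a C :
  (forall r : R, is_derive r 1 F (F1 r)) -> (forall r : R, is_derive r 1 F1 (F2 r)) ->
  (forall r, 0 <= r <= 1 -> F2 r <= a + C * r) ->
  F 1 <= F 0 + F1 0 + a / 2 + C / 6.
Proof.
move=> dF dF1 F2le.
have F1le s : 0 <= s <= 1 -> F1 s <= F1 0 + a * s + C / 2 * s ^+ 2.
  move=> /andP[s0 s1].
  have := @le_of_derive_ge0 (fun r => a * r + C / 2 * r ^+ 2 - F1 r)
    (fun r => a + C * r - F2 r) s _ _ s0.
  have dG (r : R) : is_derive r 1 (fun r => a * r + C / 2 * r ^+ 2 - F1 r)
      (a + C * r - F2 r).
    have -> : (fun r => a * r + C / 2 * r ^+ 2 - F1 r) =
      (a \*: id) + ((C / 2) \*: (id ^+ 2)) - F1 by apply/funext.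
    by apply: is_derive_eq; rewrite /= /GRing.scale /=; field.
  move=> /(_ dG); rewrite expr0n !mulr0 addr0 add0r => H.
  have /H : forall r, 0 <= r <= s -> 0 <= a + C * r - F2 r.
    move=> r /andP[r0 rs]; rewrite subr_ge0 F2le// r0/=; exact: le_trans s1.
  by lra.
have := @le_of_derive_ge0 (fun r => F1 0 * r + a / 2 * r ^+ 2 + C / 6 * r ^+ 3 - F r)
    (fun r => F1 0 + a * r + C / 2 * r ^+ 2 - F1 r) 1 _ _ ler01.
have dG (r : R) : is_derive r 1
    (fun r => F1 0 * r + a / 2 * r ^+ 2 + C / 6 * r ^+ 3 - F r)
    (F1 0 + a * r + C / 2 * r ^+ 2 - F1 r).
  have -> : (fun r => F1 0 * r + a / 2 * r ^+ 2 + C / 6 * r ^+ 3 - F r) =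
    (F1 0 \*: id) + ((a / 2) \*: (id ^+ 2)) + ((C / 6) \*: (id ^+ 3)) - F
    by apply/funext.
  by apply: is_derive_eq; rewrite /= /GRing.scale /=; field.
move=> /(_ dG); rewrite !expr0n !mulr0 !expr1n !mulr1 /= => H.
have /H : forall r, 0 <= r <= 1 -> 0 <= F1 0 + a * r + C / 2 * r ^+ 2 - F1 r.
  by move=> r r01; rewrite subr_ge0 F1le.
by lra.
Qed.

Lemma taylor2_ge (F F1 F2 : R -> R) a :
  (forall r : R, is_derive r 1 F (F1 r)) -> (forall r : R, is_derive r 1 F1 (F2 r)) ->
  (forall r, 0 <= r <= 1 -> a <= F2 r) ->
  F 0 + F1 0 + a / 2 <= F 1.
Proof.
move=> dF dF1 F2ge.
have := @taylor2_le (fun r => - F r) (fun r => - F1 r) (fun r => - F2 r) (- a) 0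
  (fun r => is_deriveN (dF r)) (fun r => is_deriveN (dF1 r)).
move=> H; have {}H : - F 1 <= - F 0 + - F1 0 + - a / 2 + 0 / 6.
  by apply: H => r /F2ge; rewrite mul0r addr0 lerN2.
by lra.
Qed.

Lemma derive_lipschitz_le (F : R -> R) (x l K : R) : is_derive x 1 F l ->
  (forall s, `|F s - F x| <= K * `|s - x|) -> `|l| <= K.
Proof.
move=> [dF <-] Flip.
have quot h : h != 0 -> `|h^-1 *: ((F \o shift x) (h *: 1) - F x)| <= K.
  move=> h0; rewrite /= normrM normfV mulrC ler_pdivrMr ?normr_gt0//.
  by apply: (le_trans (Flip _)); rewrite addrK [_%:A]mulr1.
rewrite ler_norml; apply/andP; split.
  apply: limr_ge => //; near=> h.
  have /quot : h != 0 by near: h; exact: nbhs_dnbhs_neq.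
  by rewrite ler_norml => /andP[].
apply: limr_le => //; near=> h.
have /quot : h != 0 by near: h; exact: nbhs_dnbhs_neq.
by rewrite ler_norml => /andP[].
Unshelve. all: by end_near. Qed.

Lemma is_derive_line d (f : 'cV[R]_d -> R) (x u : 'cV[R]_d) (s : R) :
  derivable f (s *: u + x) u ->
  is_derive s 1 (fun r => f (r *: u + x)) ('D_u f (s *: u + x)).
Proof.
have E : (fun h : R => h^-1 *: (((fun r => f (r *: u + x)) \o shift s) (h *: 1) -
      f (s *: u + x))) =
    (fun h : R => h^-1 *: ((f \o shift (s *: u + x)) (h *: u) - f (s *: u + x))).
  by apply/funext => h /=; rewrite [_%:A]mulr1 scalerDl addrA.
move=> df; split; first by rewrite /derivable E.
by rewrite /derive E.
Qed.

End OneVariable.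

Section Calculus.
Context {R : realType} {d : nat}.
Variable f : 'cV[R]_d -> R.
Implicit Types x u v : 'cV[R]_d.

Lemma derive_dir (g : 'cV[R]_d -> R) x u : differentiable g x ->
  'D_u g x = \sum_i 'D_(basis_vec i) g x * u i 0.
Proof.
move=> dg; rewrite deriveE//.
have {1}-> : u = \sum_i u i 0 *: basis_vec i.
  apply/matrixP => i j; rewrite ord1 summxE (bigD1 i)//= big1 => [|k ki].
    by rewrite !mxE !eqxx mulr1 addr0.
  by rewrite !mxE eq_sym (negbTE ki) mulr0.
rewrite linear_sum; apply: eq_bigr => i _.
by rewrite linearZ deriveE// mulrC.
Qed.

Hypothesis f3 : thrice_differentiable f.

Lemma derive_grad u y : 'D_u f y = dotv (grad f y) u.
Proof.
have [df _ _] := f3 y.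
by rewrite derive_dir// dotvE; apply: eq_bigr => i _; rewrite mxE.
Qed.

Lemma differentiable_grad_coord i x : differentiable (fun y => grad f y i 0) x.
Proof.
have [_ dg _] := f3 x.
exact: (differentiable_comp dg (differentiable_coord _ i 0)).
Qed.

Lemma differentiable_hess_coord i j x : differentiable (fun y => hess f y i j) x.
Proof.
have [_ _ dh] := f3 x.
exact: (differentiable_comp dh (differentiable_coord _ i j)).
Qed.

Lemma differentiable_gradv v x : differentiable (fun y => dotv (grad f y) v) x.
Proof.
have -> : (fun y => dotv (grad f y) v) =
    \sum_i (v i 0 \*: (fun y => grad f y i 0)).
  apply/funext => y; rewrite dotvE fct_sumE; apply: eq_bigr => i _.
  by rewrite mulrC.
by apply: differentiable_sum => i; apply/differentiableZ/differentiable_grad_coord.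
Qed.

Lemma differentiable_hessv u v x : differentiable (fun y => dotv (hess f y *m u) v) x.
Proof.
have -> : (fun y => dotv (hess f y *m u) v) =
    \sum_i \sum_j ((v i 0 * u j 0) \*: (fun y => hess f y i j)).
  apply/funext => y; rewrite dotvE fct_sumE; apply: eq_bigr => i _.
  rewrite fct_sumE mxE mulr_suml; apply: eq_bigr => j _ /=.
  by rewrite -mulrA mulrC /GRing.scale /=; congr (_ * _); rewrite mulrC.
apply: differentiable_sum => i; apply: differentiable_sum => j.
exact/differentiableZ/differentiable_hess_coord.
Qed.

Lemma derive_gradv u v x :
  'D_u (fun y => dotv (grad f y) v) x = dotv (hess f x *m u) v.
Proof.
have dgi i := @differentiable_grad_coord i x.
have -> : (fun y => dotv (grad f y) v) =
    \sum_i (v i 0 \*: (fun y => grad f y i 0)).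
  apply/funext => y; rewrite dotvE fct_sumE; apply: eq_bigr => i _.
  by rewrite mulrC.
rewrite derive_sum => [|i]; last exact/derivableZ/diff_derivable.
rewrite dotvE; apply: eq_bigr => i _.
rewrite deriveZ; last exact/diff_derivable.
rewrite derive_dir// mulrC /GRing.scale /=; congr (_ * _).
by rewrite mxE; apply: eq_bigr => j _; rewrite mxE.
Qed.

Lemma line_deriv x u (s : R) :
  is_derive s 1 (fun r => f (r *: u + x)) (dotv (grad f (s *: u + x)) u).
Proof.
have [df _ _] := f3 (s *: u + x).
by have := is_derive_line (@diff_derivable _ _ _ _ _ u df); rewrite derive_grad.
Qed.

Lemma line_deriv_grad x u v (s : R) :
  is_derive s 1 (fun r => dotv (grad f (r *: u + x)) v)
    (dotv (hess f (s *: u + x) *m u) v).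
Proof.
by have := is_derive_line (@diff_derivable _ _ _ _ _ u (@differentiable_gradv v (s *: u + x)));
  rewrite derive_gradv.
Qed.

Lemma line_deriv_hess x u (s : R) :
  is_derive s 1 (fun r => dotv (hess f (r *: u + x) *m u) u)
    (third_dir f (s *: u + x) u).
Proof.
have := is_derive_line (@diff_derivable _ _ _ _ _ u (@differentiable_hessv u u (s *: u + x))).
rewrite /third_dir (_ : 'D_u f = fun y => dotv (grad f y) u); last first.
  by apply/funext => y; exact: derive_grad.
rewrite (_ : 'D_u _ = fun y => dotv (hess f y *m u) u)//.
by apply/funext => y; exact: derive_gradv.
Qed.

Lemma grad_minimizer xs : minimizer f xs -> grad f xs = 0.
Proof.
move=> fmin; apply/eqP; rewrite -dotv_eq0; apply/eqP.
(* Along the gradient itself the derivative at 0 is the squared norm of the gradient. *)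
set u := grad f xs.
have d0 := @line_deriv xs u 0.
have : is_derive (0 : R) 1 (fun r : R => f (r *: u + xs)) 0.
  apply: (@derive1_at_min R _ (-1) 1) => //.
  - by move=> t _; have [] := line_deriv xs u t.
  - by rewrite in_itv/= ltrN10 ltr01.
  - by move=> t _; rewrite scale0r add0r fmin.
case=> _; case: d0 => _ ->.
by rewrite scale0r add0r.
Qed.

End Calculus.

(* The factors a and b measure the loss with respect to a quadratic objective,
   for which a = b = 1. *)
Definition local_descent (R : realType) d (f : 'cV[R]_d -> R) (xs : 'cV[R]_d)
    (del a b : R) : Prop :=
  [/\ 0 <= a, 0 <= b,
   forall x t (S : 'M[R]_(d, t)) y, f x - f xs <= del -> \rank S = t ->
     sscn_step f S x y ->
     f y <= f x - 2^-1 * a *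
       dotv (S *m invmx (S^T *m hess f xs *m S) *m S^T *m grad f x) (grad f x) &
   forall x, f x - f xs <= del ->
     b * (f x - f xs) <= 2^-1 * dotv (invmx (hess f xs) *m grad f x) (grad f x)].

(** * Descent of a cubic step and gradient dominance *)

Section Descent.
Context {R : realType} {d : nat} {f : 'cV[R]_d -> R} {M mu : R} {xs : 'cV[R]_d}.
Hypotheses (f3 : thrice_differentiable f) (M0 : 0 <= M) (fL : lipschitz_hess M f)
  (mu0 : 0 < mu) (fS : strongly_convex mu f) (fmin : minimizer f xs).

Let H := hess f xs.
Let L := opnorm H.

Lemma hess_diff_le x y u v :
  `|dotv (hess f x *m u) v - dotv (hess f y *m u) v|
  <= M * enorm (x - y) * enorm u * enorm v.
Proof.
rewrite -dotvNl -dotvDl -mulmxBl; apply: (le_trans (dotv_mulmx_le _ _ _)).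
by rewrite ler_wpM2r ?enorm_ge0// ler_wpM2r ?enorm_ge0.
Qed.

(** On the line through [x] along [u], the Hessian form at [u] is Lipschitz with this constant,
    which therefore bounds its derivative. *)
Lemma third_dir_le x u : `|third_dir f x u| <= M * enorm u ^+ 3.
Proof.
have := line_deriv_hess f3 x u 0; rewrite scale0r add0r => /derive_lipschitz_le; apply.
move=> s; rewrite scale0r add0r subr0; apply: (le_trans (hess_diff_le _ _ _ _)).
by rewrite addrK enormZ le_eqVlt; apply/orP; left; apply/eqP; ring.
Qed.

Section Sketched.
Context {t : nat} (S : 'M[R]_(d, t)).

Lemma MS_has_ubound : ubound [set r | exists (x : 'cV[R]_d) (h : 'cV[R]_t), h != 0 /\
  r = `|third_dir f x (S *m h)| / enorm (S *m h) ^+ 3] M.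
Proof.
move=> _ [x [h [_ ->]]]; have [->|n0] := eqVneq (enorm (S *m h)) 0.
  (* A nonzero [h] may have [S *m h = 0]; the quotient by 0 is 0. *)
  by rewrite expr0n invr0 mulr0.
rewrite ler_pdivrMr ?third_dir_le//.
by rewrite exprn_gt0// lt0r n0 enorm_ge0.
Qed.

Lemma MS_le : MS f S <= M.
Proof.
rewrite /MS; set E := [set r | _].
(* [E] is empty for [t = 0], and [sup] of the empty set is 0. *)
have [->|/set0P ne] := eqVneq E set0; first by rewrite sup0.
exact: ge_sup ne MS_has_ubound.
Qed.

Lemma third_dir_MS x h : `|third_dir f x (S *m h)| <= MS f S * enorm (S *m h) ^+ 3.
Proof.
have [Sh|n0] := eqVneq (enorm (S *m h)) 0.
  by rewrite (le_trans (third_dir_le _ _))// Sh expr0n !mulr0.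
have p : 0 < enorm (S *m h) ^+ 3 by rewrite exprn_gt0// lt0r n0 enorm_ge0.
rewrite -ler_pdivrMr//; apply: ub_le_sup; first by exists M; exact: MS_has_ubound.
exists x, h; split=> //; apply: contra_neq n0 => ->.
by rewrite mulmx0 enorm0.
Qed.

(** The bound on the third derivative makes the second derivative along [S *m h] grow at most
    linearly, which is the hypothesis of [taylor2_le]. *)
Lemma cubic_model_ub x h : f (x + S *m h) <= f x + cubic_model f S x h.
Proof.
set u := S *m h.
have := @taylor2_le _ (fun r => f (r *: u + x)) _ _
  (dotv (hess f x *m u) u) (MS f S * enorm u ^+ 3)
  (line_deriv f3 x u) (line_deriv_grad f3 x u u).
rewrite scale1r !scale0r !add0r addrC => le.
have -> : cubic_model f S x h = dotv (grad f x) u + dotv (hess f x *m u) u / 2 +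
    MS f S * enorm u ^+ 3 / 6.
  rewrite /cubic_model /sgrad /shess dotvC -dotv_adjoint.
  rewrite (dotvC _ (grad f x)) -/u.
  rewrite -!mulmxA (dotvC _ h) -dotv_adjoint -/u (dotvC u).
  by field.
rewrite !addrA; apply: le => r /andP[r0 r1].
have := @le_of_derive_ge0 _ (fun r => MS f S * enorm u ^+ 3 * r -
    dotv (hess f (r *: u + x) *m u) u)
  (fun r => MS f S * enorm u ^+ 3 - third_dir f (r *: u + x) u) r _ _ r0.
rewrite mulr0 add0r scale0r add0r => H0.
suff : - dotv (hess f x *m u) u <=
  MS f S * enorm u ^+ 3 * r - dotv (hess f (r *: u + x) *m u) u.
  by rewrite lerBrDr addrC lerBlDl.
apply: H0 => [s|s _].
  have -> : (fun r => MS f S * enorm u ^+ 3 * r - dotv (hess f (r *: u + x) *m u) u) =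
    ((MS f S * enorm u ^+ 3) \*: id) - (fun r => dotv (hess f (r *: u + x) *m u) u)
    by apply/funext.
  have dh := line_deriv_hess f3 x u s.
  by apply: is_derive_eq; rewrite /GRing.scale /= mulr1.
by rewrite subr_ge0 (le_trans (ler_norm _))// third_dir_MS.
Qed.

Lemma sscn_step_le x y h : sscn_step f S x y -> f y <= f x + cubic_model f S x h.
Proof.
case=> h0 hmin ->; apply: (le_trans (cubic_model_ub _ _)).
by rewrite lerD2l hmin.
Qed.

Lemma sscn_step_decr x y : sscn_step f S x y -> f y <= f x.
Proof.
move/(sscn_step_le 0); rewrite /cubic_model !mulmx0 enorm0 expr0n mulr0.
by rewrite (dotvC _ 0) !dotv0l mulr0 !addr0.
Qed.

End Sketched.

Let Hunit := loewner_unit mu0 (fS xs).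
Let Hsym := loewner_sym (fS xs).

(** Strong convexity turns the absolute error of the Lipschitz bound into a relative one:
    [enorm u ^+ 2] is at most [dotv (H *m u) u / mu]. *)
Lemma hess_quad_close x u :
  `|dotv (hess f x *m u) u - dotv (H *m u) u|
  <= M * enorm (x - xs) / mu * dotv (H *m u) u.
Proof.
apply: (le_trans (hess_diff_le _ _ _ _)).
rewrite -mulrA -expr2 enorm_sqr -!mulrA ler_wpM2l// ler_wpM2l ?enorm_ge0//.
by rewrite mulrC ler_pdivlMr// mulrC; exact: loewner_quad (fS xs) u.
Qed.

Lemma hess_quad_le x u q : dotv (H *m u) u = q ->
  dotv (hess f x *m u) u - q <= M * enorm (x - xs) / mu * q.
Proof. by move=> <-; exact: (le_trans (ler_norm _) (hess_quad_close x u)). Qed.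

Lemma hess_quad_ge x u q : dotv (H *m u) u = q ->
  q - dotv (hess f x *m u) u <= M * enorm (x - xs) / mu * q.
Proof.
move=> <-; apply: (le_trans (ler_norm _)); rewrite distrC.
exact: hess_quad_close x u.
Qed.

(** The left side of the conclusion is the model at the trial step, with linear term [- q], Hessian
    form [e] and cubic term [c]; [a] and [b] are the errors of the last two relative to [q]. *)
Lemma cubic_step_arith (a b c e q : R) : e - q <= a * q -> c <= b * q ->
  - q + 2^-1 * e + c <= - (2^-1 * (1 - a - 2 * b) * q).
Proof. by move=> *; lra. Qed.

Lemma cubic_step_descent t (S : 'M[R]_(d, t)) x y : \rank S = t -> sscn_step f S x y ->
  f y <= f x -
    2^-1 * (1 - M * enorm (x - xs) / mu - M * enorm (grad f x) / (3 * mu ^+ 2)) *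
    dotv (S *m invmx (S^T *m H *m S) *m S^T *m grad f x) (grad f x).
Proof.
move=> rS Sxy; set g := grad f x; move PE : (S *m _ *m _) => P.
(* The Newton step in the range of [S] for the fixed Hessian [H], so that [P] does not depend on
   [x]. *)
pose h := - (invmx (S^T *m H *m S) *m (S^T *m g)).
have Sh : S *m h = - (P *m g) by rewrite -PE mulmxN !mulmxA.
apply: (le_trans (sscn_step_le h Sxy)); rewrite lerD2l.
have Pq := projS_quad mu0 (fS xs) rS g; rewrite PE in Pq.
have Pn := projS_norm mu0 (fS xs) rS g; rewrite PE in Pn.
have P2 := projS_quad_ge mu0 (fS xs) rS g; rewrite PE in P2.
have P0 := projS_quad_ge0 mu0 (fS xs) rS g; rewrite PE in P0.
set q := dotv (P *m g) g in Pq P2 P0 *.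
rewrite /cubic_model /sgrad /shess.
have -> : dotv (S^T *m grad f x) h = - q.
  by rewrite dotvC -dotv_adjoint Sh dotvNl.
have -> : dotv (S^T *m hess f x *m S *m h) h =
    dotv (hess f x *m (P *m g)) (P *m g).
  rewrite -(mulmxA _ S) -(mulmxA S^T) (dotvC _ h) -dotv_adjoint Sh mulmxN dotvNl dotvNr opprK.
  exact: dotvC.
have hq := hess_quad_le x (esym Pq).
(* One factor |P g| is at most |g| / mu and the other two give at most q / mu, so the cubic term is
   a multiple of [q]. *)
have cub : MS f S / 6 * enorm (S *m h) ^+ 3 <= M * enorm g / (6 * mu ^+ 2) * q.
  have m2 : enorm (P *m g) ^+ 2 <= q / mu.
    by rewrite enorm_sqr ler_pdivlMr// mulrC.
  have -> : M * enorm g / (6 * mu ^+ 2) * q = M / 6 * (enorm g / mu * (q / mu)).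
    by field; rewrite gt_eqF.
  apply: (@le_trans _ _ (M / 6 * enorm (S *m h) ^+ 3)).
    by rewrite ler_wpM2r ?exprn_ge0 ?enorm_ge0// ler_wpM2r ?invr_ge0// MS_le.
  rewrite ler_wpM2l ?divr_ge0// Sh enormN exprS.
  by rewrite ler_pM ?enorm_ge0 ?sqr_ge0.
have -> : M * enorm g / (3 * mu ^+ 2) = 2 * (M * enorm g / (6 * mu ^+ 2)).
  by field; rewrite gt_eqF.
exact: cubic_step_arith hq cub.
Qed.

Lemma strong_convexity_growth x : mu / 2 * enorm (x - xs) ^+ 2 <= f x - f xs.
Proof.
set u := x - xs.
have := taylor2_ge (a := mu * dotv u u) (line_deriv f3 xs u) (line_deriv_grad f3 xs u u).
rewrite scale1r !scale0r !add0r subrK (grad_minimizer f3 fmin) dotv0l addr0 => H0.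
rewrite lerBrDl enorm_sqr mulrAC; apply: H0 => r _.
exact: loewner_quad (fS _) u.
Qed.

(** Let b be the factor on the left, u = xs - x, q the form of [H] at u, and e the product of the
    gradient with u. If b > 0, the Hessian is at least b H on the segment, so f xs >= f x + e + b q
    / 2; expanding the form of [H] at H^-1 g + b u bounds - b e - b^2 q / 2 by half of g^T H^-1
    g. *)
Lemma gradient_dominance x :
  (1 - M * enorm (x - xs) / mu) * (f x - f xs) <=
  2^-1 * dotv (invmx H *m grad f x) (grad f x).
Proof.
have Hpsd := loewner_psd mu0 (fS xs).
set b := 1 - _; set g := grad f x.
have [b0|b0] := leP b 0.
  apply: (@le_trans _ _ 0); first by rewrite mulr_le0_ge0// subr_ge0 fmin.
  rewrite mulr_ge0//; have := Hpsd.2 (invmx H *m g).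
  by rewrite mulmxA mulmxV// mul1mx dotvC.
move uE : (xs - x) => u; set q := dotv (H *m u) u.
have q0 : 0 <= q by exact: Hpsd.2.
have := taylor2_ge (a := b * q) (line_deriv f3 x u) (line_deriv_grad f3 x u u).
have ux : u + x = xs by rewrite -uE subrK.
rewrite scale1r !scale0r !add0r ux -/g => H0.
have {}H0 : f x + dotv g u + (b * q) / 2 <= f xs.
  apply: H0 => r /andP[r0 r1].
  have := @hess_quad_ge (r *: u + x) u q erefl.
  (* No point of the segment is farther from [xs] than [x], so the error at [x] serves for all. *)
  have -> : r *: u + x - xs = (1 - r) *: (x - xs).
    by rewrite -uE; apply/matrixP => i j; rewrite !mxE; ring.
  rewrite enormZ (ger0_norm (_ : 0 <= 1 - r)); last by rewrite subr_ge0.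
  have aux (e c n : R) : 0 <= n -> c <= 1 -> q - e <= M * (c * n) / mu * q ->
      (1 - M * n / mu) * q <= e.
    move=> n0 c1; have : M * (c * n) / mu * q <= M * n / mu * q.
      rewrite ler_wpM2r// ler_wpM2r ?invr_ge0 ?(ltW mu0)// ler_wpM2l//.
      by rewrite ler_piMl.
    by move=> ? ?; lra.
  by apply: aux; [exact: enorm_ge0|rewrite lerBlDl lerDr].
have := Hpsd.2 (invmx H *m g + b *: u).
rewrite mulmxDr mulmxA mulmxV// mul1mx -scalemxAr.
rewrite !(dotvDl, dotvDr, dotvZl, dotvZr) -/q.
have -> : dotv (H *m u) (invmx H *m g) = dotv g u.
  by rewrite dotv_sym// mulmxA mulmxV// mul1mx; exact: dotvC.
rewrite (dotvC (invmx H *m g)).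
move: (dotv g (invmx H *m g)) (dotv g u) H0 => G e H0 hG.
have aux (F F' : R) : F + e + (b * q) / 2 <= F' ->
  0 <= G + b * e + b * (e + b * q) -> b * (F - F') <= 2^-1 * G.
  move=> h1 h2; have := ler_wpM2l (ltW b0) h1; lra.
by apply: aux H0 _; move: hG; congr (0 <= _); ring.
Qed.

(** The gradient vanishes at [xs]; follow its product with the fixed vector [g] along the segment,
    where the Hessian differs from [H] by at most [M * enorm (x - xs)]. *)
Lemma grad_norm_le x : enorm (grad f x) <=
  (L + M * enorm (x - xs)) * enorm (x - xs).
Proof.
set g := grad f x; set u := x - xs.
have [g0|g0] := eqVneq (enorm g) 0.
  rewrite g0 mulr_ge0 ?enorm_ge0// addr_ge0 ?opnorm_ge0// mulr_ge0 ?enorm_ge0//.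
have gp : 0 < enorm g by rewrite lt0r g0 enorm_ge0.
rewrite -(ler_pM2r gp) -expr2 enorm_sqr.
set K := (L + _) * _ * _.
have := @le_of_derive_ge0 _ (fun r => K * r - dotv (grad f (r *: u + xs)) g)
  (fun r => K - dotv (hess f (r *: u + xs) *m u) g) 1 _ _ ler01.
rewrite mulr0 scale0r !add0r (grad_minimizer f3 fmin) dotv0l oppr0 mulr1 scale1r subrK.
rewrite subr_ge0; apply => [s|r /andP[r0 r1]].
  have -> : (fun r => K * r - dotv (grad f (r *: u + xs)) g) =
    (K \*: id) - (fun r => dotv (grad f (r *: u + xs)) g) by apply/funext.
  have dh := line_deriv_grad f3 xs u g s.
  by apply: is_derive_eq; rewrite /GRing.scale /= mulr1.
rewrite subr_ge0 (le_trans (ler_norm _))//.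
rewrite -(subrK (dotv (H *m u) g) (dotv (hess f _ *m u) g)).
apply: (le_trans (ler_normD _ _)).
apply: (@le_trans _ _ (M * enorm u * enorm u * enorm g + L * enorm u * enorm g)); last first.
  by rewrite /K le_eqVlt; apply/orP; left; apply/eqP; ring.
apply: lerD; last exact: dotv_mulmx_le.
apply: (le_trans (hess_diff_le _ _ _ _)).
rewrite addrK ler_wpM2r ?enorm_ge0// ler_wpM2r ?enorm_ge0// ler_wpM2l//.
by rewrite enormZ ger0_norm// ler_piMl ?enorm_ge0.
Qed.

Lemma sublevel_radius del rho x : 0 <= rho -> del <= mu / 2 * rho ^+ 2 ->
  f x - f xs <= del -> enorm (x - xs) <= rho.
Proof.
move=> rho0 dr fx; rewrite -ler_sqr ?nnegrE ?enorm_ge0//.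
have m2 : 0 < mu / 2 by rewrite divr_gt0.
rewrite -(ler_pM2l m2).
exact: le_trans (strong_convexity_growth x) (le_trans fx dr).
Qed.

(** Serves integrability; [del] is arbitrary because the quadratic case admits every starting
    point. *)
Lemma grad_bounded del : exists G, forall x, f x - f xs <= del ->
  enorm (grad f x) <= G.
Proof.
have [d0|d0] := ltP del 0.
  exists 0 => x fx; have := fmin x; rewrite -subr_ge0 => /le_lt_trans/(_ (le_lt_trans fx d0)).
  by rewrite ltxx.
pose rho := Num.sqrt (2 * del / mu).
have rho0 : 0 <= rho by exact: sqrtr_ge0.
exists ((L + M * rho) * rho) => x fx.
have rx : enorm (x - xs) <= rho.
  apply: (sublevel_radius rho0 _ fx); rewrite sqr_sqrtr; last first.
    by rewrite divr_ge0 ?mulr_ge0// ltW.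
  by rewrite le_eqVlt; apply/orP; left; apply/eqP; field; rewrite gt_eqF.
apply: (le_trans (grad_norm_le x)); apply: ler_pM; rewrite ?enorm_ge0//.
  by rewrite addr_ge0 ?opnorm_ge0// mulr_ge0 ?enorm_ge0.
by rewrite lerD2l ler_wpM2l.
Qed.

Lemma local_descent_quadratic del : M = 0 -> local_descent f xs del 1 1.
Proof.
move=> Mz; split=> // [x t S y _ rS Sxy|x _].
  have := cubic_step_descent rS Sxy; rewrite Mz !mul0r !subr0 !mulr1.
  exact.
by have := gradient_dominance x; rewrite Mz !mul0r subr0.
Qed.

Lemma local_descent_exists eps : 0 < eps <= 1 ->
  exists del a b, [/\ 0 < del, local_descent f xs del a b & 1 - eps <= a * b].
Proof.
move=> /andP[e0 e1].
have L0 : 0 <= L by exact: opnorm_ge0.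
(* Within distance [rho <= 1] of [xs] the gradient is at most [(L + M) * rho], so the Hessian and
   cubic errors are at most [c1 * rho] and [c2 * rho]. *)
pose c1 := M / mu; pose c2 := M * (L + M) / (3 * mu ^+ 2).
have c10 : 0 <= c1 by rewrite divr_ge0// ltW.
have c20 : 0 <= c2.
  by apply: divr_ge0; apply: mulr_ge0 => //; [exact: addr_ge0|exact: sqr_ge0].
(* The Hessian error enters both [a] and [b], hence the 2. The summand 1 ensures [rho <= 1], and
   [K > 0] even if M = 0. *)
pose K := 2 * c1 + c2 + 1.
have K1 : 1 <= K by rewrite lerDr; apply: addr_ge0 => //; exact: mulr_ge0.
have K0 : 0 < K by exact: lt_le_trans K1.
pose rho := eps / K.
have rho0 : 0 < rho by rewrite divr_gt0.
have rho1 : rho <= 1 by rewrite ler_pdivrMr// mul1r (le_trans e1).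
have rhoK : (2 * c1 + c2) * rho <= eps.
  by rewrite mulrA ler_pdivrMr// mulrC ler_pM2l// lerDl.
pose a := 1 - c1 * rho - c2 * rho; pose b := 1 - c1 * rho.
have cr1 : 0 <= c1 * rho by rewrite mulr_ge0// ltW.
have cr2 : 0 <= c2 * rho by rewrite mulr_ge0// ltW.
have ab : 1 - eps <= a * b.
  rewrite /a /b; move: rhoK cr1 cr2; rewrite mulrDl -mulrA.
  by move: (c1 * rho) (c2 * rho) => x y *; nra.
have a0 : 0 <= a.
  rewrite /a; move: rhoK cr1 cr2; rewrite mulrDl -mulrA.
  by move: (c1 * rho) (c2 * rho) => x y *; lra.
have b0 : 0 <= b by rewrite (le_trans a0)// /a /b gerBl.
(* By quadratic growth this sublevel set lies in the ball of radius [rho] around [xs]. *)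
exists (mu / 2 * rho ^+ 2), a, b; split=> //.
  by rewrite mulr_gt0 ?divr_gt0 ?exprn_gt0.
split=> // [x t S y fx rS Sxy|x fx].
  have rx := sublevel_radius (ltW rho0) (lexx _) fx.
  apply: (le_trans (cubic_step_descent rS Sxy)); rewrite lerD2l lerN2.
  rewrite ler_wpM2r ?(projS_quad_ge0 mu0 (fS xs) rS)// ler_wpM2l//.
  have k1 : M * enorm (x - xs) / mu <= c1 * rho.
    by rewrite mulrAC ler_wpM2l.
  have k2 : M * enorm (grad f x) / (3 * mu ^+ 2) <= c2 * rho.
    have mu2 : 0 <= (3 * mu ^+ 2)^-1 by rewrite invr_ge0 mulr_ge0 ?sqr_ge0.
    rewrite /c2 [leRHS]mulrAC ler_wpM2r// -mulrA ler_wpM2l//; apply: (le_trans (grad_norm_le x)).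
    apply: ler_pM; rewrite ?enorm_ge0//.
      by rewrite addr_ge0 ?opnorm_ge0// mulr_ge0 ?enorm_ge0.
    by rewrite lerD2l ler_piMr// (le_trans rx).
  by rewrite /a -!addrA lerD2l -!opprD lerN2 lerD.
have rx := sublevel_radius (ltW rho0) (lexx _) fx.
apply: le_trans (gradient_dominance x); rewrite ler_wpM2r ?subr_ge0 ?fmin//.
by rewrite /b lerD2l lerN2 mulrAC ler_wpM2l.
Qed.

End Descent.

(** * Measurability and independence *)

Section MeasurableMatrix.
Context {R : realType} {dT : measure_display} {T : measurableType dT}.

(** Inversion is continuous only away from 0, so the point 0 and its open complement are treated
    apart. *)
Lemma measurable_funV (F : T -> R) :
  measurable_fun [set: T] F -> measurable_fun [set: T] (fun x => (F x)^-1).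
Proof.
move=> mF; apply: (measurableT_comp _ mF).
rewrite -(setUv [set (0 : R)]).
apply/measurable_funU; [exact: measurable_set1|by apply: measurableC; exact: measurable_set1|].
split; first exact: measurable_fun_set1.
apply: open_continuous_measurable_fun.
  by apply: closed_openC; exact: closed_eq.
move=> x; rewrite inE /= => /eqP x0; exact: inv_continuous.
Qed.

Definition measurable_mx m n (F : T -> 'M[R]_(m, n)) : Prop :=
  forall i j, measurable_fun [set: T] (fun x => F x i j).

Lemma measurable_mx_cst m n (A : 'M[R]_(m, n)) : measurable_mx (fun=> A).
Proof. move=> i j; exact: (@measurable_cst _ _ _ _ setT (A i j)). Qed.

Lemma measurable_mx_tr m n (F : T -> 'M[R]_(m, n)) :
  measurable_mx F -> measurable_mx (fun x => (F x)^T).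
Proof. by move=> mF i j; under eq_fun do rewrite mxE; exact: mF. Qed.

Lemma measurable_mx_mul m n p (F : T -> 'M[R]_(m, n)) (G : T -> 'M[R]_(n, p)) :
  measurable_mx F -> measurable_mx G -> measurable_mx (fun x => F x *m G x).
Proof.
move=> mF mG i j; under eq_fun do rewrite mxE.
by apply: measurable_sum => k; apply: measurable_funM; [exact: mF|exact: mG].
Qed.

Lemma measurable_det n (F : T -> 'M[R]_n) :
  measurable_mx F -> measurable_fun [set: T] (fun x => \det (F x)).
Proof.
move=> mF; rewrite /determinant; apply: measurable_sum => s.
apply: measurable_funM; first exact: measurable_cst.
by apply: measurable_prod => i _; exact: mF.
Qed.

Lemma measurable_mx_inv n (F : T -> 'M[R]_n) :
  measurable_mx F -> measurable_mx (fun x => invmx (F x)).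
Proof.
move=> mF i j.
(* [invmx] leaves a singular matrix unchanged; elsewhere Cramer's rule applies. *)
have -> : (fun x => invmx (F x) i j) =
  (fun x => if \det (F x) == 0 then F x i j else (\det (F x))^-1 * cofactor (F x) j i).
  apply/funext => x; rewrite /invmx unitmxE unitfE.
  by case: eqVneq => //= _; rewrite !mxE.
have mdet := measurable_det mF.
apply: measurable_fun_ifT.
- by apply: measurable_fun_eqr => //; exact: measurable_cst.
- exact: mF.
apply: measurable_funM; first exact: measurable_funV.
apply: measurable_funM; first exact: measurable_cst.
apply: measurable_det => k l; under eq_fun do rewrite !mxE.
exact: mF.
Qed.

(* Measurability of a continuous function of finitely many measurable
   coordinates: round the point down to the grid of step 1/(n+1), on which the
   function takes countably many values, and let n tend to infinity. *)
Lemma measurable_continuous_comp d (X : T -> 'cV[R]_d) (h : 'cV[R]_d -> R) :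
  (forall j, measurable_fun [set: T] (fun w => X w j 0)) -> continuous h ->
  measurable_fun [set: T] (h \o X).
Proof.
move=> mX ch.
pose z n w : 'cV[int]_d := \col_j Num.floor (n.+1%:R * X w j 0).
pose q n (a : 'cV[int]_d) : 'cV[R]_d := \col_j (n.+1%:R^-1 * (a j 0)%:~R).
apply: (@measurable_fun_cvg _ _ _ _ (fun n w => h (q n (z n w)))) => [n|w _].
  move=> _ B mB; rewrite setTI.
  have -> : (fun w => h (q n (z n w))) @^-1` B =
      \bigcup_(a in [set a | B (h (q n a))]) [set w | z n w = a].
    apply/seteqP; split=> [w Bw|w [a Ba] /= wa]; first by exists (z n w).
    by rewrite wa.
  rewrite bigcup_mkcond; apply: countable_bigcupT_measurable => // a.
  case: ifP => // _.
  have -> : [set w | z n w = a] =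
      \bigcap_(j in [set: 'I_d]) [set w | (a j 0)%:~R <= n.+1%:R * X w j 0 < (a j 0 + 1)%:~R].
    apply/seteqP; split=> w /= => [<- j _|zj]; first by rewrite mxE; exact: floor_itv.
    by apply/matrixP => j k; rewrite ord1 mxE; apply: floor_def; exact: zj.
  apply: fin_bigcap_measurable; [exact: finite_finset|move=> j _].
  have mc : measurable_fun [set: T] (fun w => n.+1%:R * X w j 0).
    by apply: measurable_funM; [exact: measurable_cst|exact: mX].
  rewrite -[X in measurable X]setTI.
  have := mc measurableT `[(a j 0)%:~R, (a j 0 + 1)%:~R[%classic (measurable_itv _).
  by congr (measurable (_ `&` _)); apply/seteqP; split=> w /=; rewrite in_itv.
suff : (fun n => q n (z n w)) @ \oo --> X w by move=> qX; exact: (cvg_comp _ _ qX (ch (X w))).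
apply/cvgrPdist_le => e e0; near=> n.
rewrite /Num.Def.normr/= mx_normrE; apply: bigmax_le; [exact: ltW|move=> -[j k] _ /=].
rewrite ord1 !mxE; set y := X w j 0.
have n0 : (0 : R) < n.+1%:R by [].
have -> : y - n.+1%:R^-1 * (Num.floor (n.+1%:R * y))%:~R =
    n.+1%:R^-1 * (n.+1%:R * y - (Num.floor (n.+1%:R * y))%:~R).
  by rewrite mulrBr mulKf// gt_eqF.
rewrite normrM ger0_norm ?invr_ge0//.
have /andP[f1 f2] := floor_itv (n.+1%:R * y).
rewrite ger0_norm ?subr_ge0//.
apply: (@le_trans _ _ n.+1%:R^-1).
  rewrite ler_piMr ?invr_ge0// lerBlDl ltW//.
  by move: f2; rewrite intrD.
by apply: ltW; near: n; exact: (near_infty_natSinv_lt (PosNum e0)).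
Unshelve. all: by end_near. Qed.

End MeasurableMatrix.

Section SketchMeasurability.
Context {R : realType} {d : nat}.

(** The type of the matrix depends on the tag. A cast to width [t], with default 0 on other tags,
    makes the entries real functions on the whole space. *)
Definition sketch_mx t (S : sketch R d) : 'M[R]_(d, t) :=
  if @eqP _ (tag S) t is ReflectT e then castmx (erefl, e) (tagged S) else 0.

Lemma sketch_mx_tagged t (A : 'M[R]_(d, t)) :
  sketch_mx t (Tagged (fun t => 'M[R]_(d, t)) A) = A.
Proof. by rewrite /sketch_mx; case: eqP => // e; rewrite castmx_id. Qed.

Lemma sketch_mx_neq t (S : sketch R d) : tag S <> t -> sketch_mx t S = 0.
Proof. by rewrite /sketch_mx; case: eqP. Qed.

Lemma measurable_tag t : measurable [set S : sketch R d | tag S = t].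
Proof. by apply: sub_sigma_algebra; left; exists t. Qed.

Lemma measurable_sketch_mx t : measurable_mx (sketch_mx t).
Proof.
move=> i j _ B mB; rewrite setTI.
(* The points of another tag have the default entry 0, so they belong to the preimage exactly when 0
   is in [B]. *)
pose N : set (sketch R d) := if 0 \in B then ~` [set S | tag S = t] else set0.
have -> : (fun S => sketch_mx t S i j) @^-1` B =
   [set S : sketch R d | exists2 A : 'M[R]_(d, t),
            S = Tagged (fun t => 'M[R]_(d, t)) A & B (A i j)] `|` N.
  apply/seteqP; split => [S /=|S [[A -> BA]|]].
  - have [tS|tS] := pselect (tag S = t).
      case: S tS => t' A /= tt'; subst t'; rewrite sketch_mx_tagged => BA.
      by left; exists A.
    by rewrite sketch_mx_neq// mxE => B0; right; rewrite /N mem_set.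
  - by rewrite /= sketch_mx_tagged.
  - rewrite /N; case: ifPn => // B0 tS.
    by rewrite /= sketch_mx_neq// mxE; rewrite inE in B0.
apply: measurableU.
  by apply: sub_sigma_algebra; right; exists t, i, j, B.
by rewrite /N; case: ifP => // _; apply: measurableC; exact: measurable_tag.
Qed.

(** The space is cut into countably many pieces of constant width; on each, [sketch_mx] gives the
    same matrix with a fixed type. *)
Lemma measurable_proj_term (H : 'M[R]_d) i j :
  measurable_fun [set: sketch R d] (fun S => proj_term H S i j).
Proof.
have -> : [set: sketch R d] = \bigcup_t [set S | tag S = t].
  by apply/seteqP; split=> S // _; exists (tag S).
apply/measurable_fun_bigcup => [t|t]; first exact: measurable_tag.
pose F (S : sketch R d) :=
  (sketch_mx t S *m invmx ((sketch_mx t S)^T *m H *m sketch_mx t S) *m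
   (sketch_mx t S)^T) i j.
apply: (@eq_measurable_fun _ _ _ _ _ F).
  move=> -[t' A]; rewrite inE /= => tt'; subst t'.
  by rewrite /F sketch_mx_tagged.
apply: measurable_funTS; have mS := @measurable_sketch_mx t.
have mST := measurable_mx_tr mS.
suff mF : measurable_mx (fun S : sketch R d =>
  sketch_mx t S *m invmx ((sketch_mx t S)^T *m H *m sketch_mx t S) *m
   (sketch_mx t S)^T) by exact: mF.
apply: measurable_mx_mul => //; apply: measurable_mx_mul => //.
apply: measurable_mx_inv; apply: measurable_mx_mul => //.
by apply: measurable_mx_mul => //; exact: measurable_mx_cst.
Qed.

End SketchMeasurability.

(** * Independence and integrals of real functions *)

Section Independence.
Context {R : realType} {dO : measure_display} {Omega : measurableType dO}.
Variable P : probability Omega R.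

Lemma ae_bounded_integrable (F : Omega -> R) (c : R) : measurable_fun [set: Omega] F ->
  {ae P, forall w, `|F w| <= c} -> P.-integrable [set: Omega] (EFin \o F).
Proof.
move=> mF Fc; apply/integrableP; split; first exact/measurable_EFinP.
have /integrableP[_] := finite_measure_integrable_cst P `|c| measurableT.
apply: le_lt_trans; apply: ae_ge0_le_integral => //.
- by apply/measurableT_comp => //; exact/measurable_EFinP.
- by apply/measurableT_comp => //; exact/measurable_EFinP.
apply: filterS Fc => w Fw _.
by rewrite /= lee_fin normr_id (le_trans Fw)// ler_norm.
Qed.

(** Agreement on rectangles identifies the joint law with the product of the marginals; then
    Fubini. *)
Lemma integral_indep (Y Z : Omega -> R) :
  measurable_fun [set: Omega] Y -> measurable_fun [set: Omega] Z ->
  (forall A B, measurable A -> measurable B ->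
    P (Y @^-1` A `&` Z @^-1` B) = P (Y @^-1` A) * P (Z @^-1` B))%E ->
  P.-integrable [set: Omega] (EFin \o Y) -> P.-integrable [set: Omega] (EFin \o Z) ->
  P.-integrable [set: Omega] (fun w => (Y w * Z w)%:E) ->
  (\int[P]_w (Y w * Z w)%:E = \int[P]_w (Y w)%:E * \int[P]_w (Z w)%:E)%E.
Proof.
move=> mY mZ ind iY iZ iYZ.
pose Y' : {mfun Omega >-> R} := HB.pack Y (isMeasurableFun.Build _ _ _ _ Y mY).
pose Z' : {mfun Omega >-> R} := HB.pack Z (isMeasurableFun.Build _ _ _ _ Z mZ).
have mW := measurable_fun_pair mY mZ.
pose W' : {mfun Omega >-> (R * R)%type} :=
  HB.pack (fun w => (Y w, Z w)) (isMeasurableFun.Build _ _ _ _ _ mW).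
pose m1 := distribution P Y'; pose m2 := distribution P Z'.
pose f (p : R * R) := (p.1 * p.2)%:E.
have mf : measurable_fun [set: R * R] f.
  by apply/measurable_EFinP; apply: measurable_funM;
    [exact: measurable_fst|exact: measurable_snd].
have W12 (X : set (R * R)) : measurable X -> (m1 \x m2)%E X = distribution P W' X.
  by move=> mX; apply: (product_measure_unique (m1 := m1) (m2 := m2)).
have ifW : (distribution P W').-integrable [set: R * R] f.
  exact: (integrable_pushforward mW).
have if12 : (m1 \x m2)%E.-integrable [set: R * R] f.
  apply/integrableP; split=> //.
  rewrite (eq_measure_integral (distribution P W')) => [|X mX _]; last exact: W12.
  by have /integrableP[] := ifW.
have i1 : m1.-integrable [set: R] EFin by exact: (integrable_pushforward mY).
have i2 : m2.-integrable [set: R] EFin by exact: (integrable_pushforward mZ).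
have e1 : (\int[m1]_y y%:E = \int[P]_w (Y w)%:E)%E by exact: (integral_distribution (X := Y')).
have e2 : (\int[m2]_y y%:E = \int[P]_w (Z w)%:E)%E by exact: (integral_distribution (X := Z')).
rewrite -e1 -e2.
transitivity (\int[distribution P W']_p f p)%E.
  by rewrite (integral_distribution (X := W')).
rewrite -(eq_measure_integral (distribution P W') (m1 := (m1 \x m2)%E)) => [|X mX _]; last exact: W12.
rewrite -(integral12_prod_meas1 if12).
have f2 : (\int[m2]_y y%:E)%E \is a fin_num by exact: integrable_fin_num.
rewrite -(fineK f2) muleC -integralZl//; apply: eq_integral => x _.
rewrite /fubini_F /f/=; under eq_integral do rewrite EFinM.
by rewrite integralZl// muleC fineK// EFinM.
Qed.

End Independence.

Section RealIntegral.
Context {R : realType} {dO : measure_display} {Omega : measurableType dO}.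
Variable P : probability Omega R.

Local Notation integ F := (P.-integrable [set: Omega] (EFin \o F)).

Lemma integ_lin (F G : Omega -> R) (c : R) : integ F -> integ G ->
  integ (fun w => F w + c * G w).
Proof.
move=> iF iG; have := integrableD measurableT iF (integrableZl measurableT c iG).
by apply: eq_integrable.
Qed.

Lemma Rintegral_lin (F G : Omega -> R) (c : R) : integ F -> integ G ->
  \int[P]_w (F w + c * G w) = \int[P]_w F w + c * \int[P]_w G w.
Proof.
move=> iF iG; rewrite RintegralD// ?RintegralZl//.
have := integrableZl measurableT c iG.
by apply: eq_integrable.
Qed.

Lemma integ_sum I (s : seq I) (F : I -> Omega -> R) : (forall i, integ (F i)) ->
  integ (fun w => \sum_(i <- s) F i w).
Proof.
move=> iF; have := @integrable_sum _ _ _ P _ measurableT _ s xpredT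
  (fun i => EFin \o F i) (fun i _ => iF i).
by apply: eq_integrable => // w _ /=; rewrite sumEFin.
Qed.

Lemma Rintegral_sum I (s : seq I) (F : I -> Omega -> R) : (forall i, integ (F i)) ->
  \int[P]_w (\sum_(i <- s) F i w) = \sum_(i <- s) \int[P]_w F i w.
Proof.
move=> iF; elim: s => [|i s IH].
  rewrite big_nil; under eq_Rintegral do rewrite big_nil.
  by rewrite Rintegral_cst// mul0r.
rewrite big_cons; under eq_Rintegral do rewrite big_cons.
by rewrite RintegralD ?IH//; exact: integ_sum.
Qed.

Lemma Rintegral_probability_cst (c : R) : \int[P]_w c = c.
Proof.
rewrite Rintegral_cst// -[RHS]mulr1; congr (_ * _).
by rewrite -[RHS]/(fine 1%E) -(probability_setT P).
Qed.

Lemma ae_le_Rintegral (F G : Omega -> R) : integ F -> integ G ->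
  {ae P, forall w, F w <= G w} -> \int[P]_w F w <= \int[P]_w G w.
Proof.
move=> iF iG FG.
have iGF := integrableB measurableT iG iF.
have mGF : measurable_fun [set: Omega] (fun w => G w - F w).
  by apply/measurable_EFinP; have /integrableP[] := iGF.
rewrite -subr_ge0 -RintegralB// /Rintegral.
(* The difference is nonnegative only almost everywhere; its absolute value is so everywhere and has
   the same integral. *)
rewrite (ae_eq_integral (fun w => `|(G w - F w)%R|%:E)) //.
- by rewrite fine_ge0// integral_ge0// => w _; rewrite lee_fin.
- exact/measurable_EFinP.
- by apply/measurable_EFinP; exact: measurableT_comp.
by apply: filterS FG => w FGw _ /=; rewrite ger0_norm// subr_ge0.
Qed.

End RealIntegral.

(** Separates [A] from [g], so that means and independence can be applied entry by entry. *)
Lemma dotv_quadE (R : realType) n (A : 'M[R]_n) g :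
  dotv (A *m g) g = \sum_i \sum_j A i j * (g i 0 * g j 0).
Proof.
rewrite dotvE; apply: eq_bigr => i _; rewrite mxE mulr_suml.
by apply: eq_bigr => j _; ring.
Qed.

Section MeanProjection.
Context {R : realType} {d : nat} {D : probability (sketch R d) R} {H : 'M[R]_d} {mu : R}.
Hypotheses (mu0 : 0 < mu) (HC : loewner_ge H mu%:M)
  (Dfull : {ae D, forall S, full_col_rank S}).

Lemma proj_term_ae_bounded i j : {ae D, forall S, `|proj_term H S i j| <= mu^-1}.
Proof. by apply: filterS Dfull => S rS; exact: projS_coord. Qed.

Lemma proj_term_integrable i j :
  D.-integrable [set: sketch R d] (EFin \o (fun S => proj_term H S i j)).
Proof.
exact: ae_bounded_integrable (measurable_proj_term H i j) (proj_term_ae_bounded i j).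
Qed.

Lemma EprojE i j : Eproj D H i j = \int[D]_S proj_term H S i j.
Proof. by rewrite mxE unlock. Qed.

Lemma Eproj_quadE g :
  dotv (Eproj D H *m g) g = \int[D]_S dotv (proj_term H S *m g) g.
Proof.
under eq_Rintegral do rewrite dotv_quadE.
have iP i j c : D.-integrable [set: sketch R d] (EFin \o (fun S => proj_term H S i j * c)).
  have := integrableZr measurableT c (proj_term_integrable i j).
  by apply: eq_integrable.
rewrite Rintegral_sum => [|i]; last exact: integ_sum.
rewrite dotv_quadE; apply: eq_bigr => i _; rewrite Rintegral_sum//.
apply: eq_bigr => j _; rewrite RintegralZr//; last exact: proj_term_integrable.
by rewrite EprojE.
Qed.

Lemma proj_quad_integrable g :
  D.-integrable [set: sketch R d] (EFin \o (fun S => dotv (proj_term H S *m g) g)).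
Proof.
have -> : (fun S => dotv (proj_term H S *m g) g) =
    (fun S => \sum_i \sum_j proj_term H S i j * (g i 0 * g j 0)).
  by apply/funext => S; rewrite dotv_quadE.
apply: integ_sum => i; apply: integ_sum => j.
have := integrableZr measurableT (g i 0 * g j 0) (proj_term_integrable i j).
by apply: eq_integrable.
Qed.

Lemma Eproj_sym : (Eproj D H)^T = Eproj D H.
Proof.
apply/matrixP => i j; rewrite mxE !EprojE; apply: eq_Rintegral => S _.
by rewrite -[proj_term H S in RHS](projS_sym HC) [RHS]mxE.
Qed.

Lemma Eproj_quad_ge0 g : 0 <= dotv (Eproj D H *m g) g.
Proof.
rewrite Eproj_quadE; have := @ae_le_Rintegral _ _ _ D (fun=> 0)
  (fun S => dotv (proj_term H S *m g) g).
rewrite Rintegral_probability_cst; apply; first exact: (finite_measure_integrable_cst D 0 measurableT).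
  exact: proj_quad_integrable.
by apply: filterS Dfull => S rS; exact: (projS_quad_ge0 mu0 HC rS).
Qed.

Lemma Eproj_quad_le g : dotv (Eproj D H *m g) g <= dotv (invmx H *m g) g.
Proof.
rewrite Eproj_quadE; set c := dotv (invmx H *m g) g.
have := @ae_le_Rintegral _ _ _ D (fun S => dotv (proj_term H S *m g) g) (fun=> c).
rewrite Rintegral_probability_cst; apply.
- exact: proj_quad_integrable.
- exact: (finite_measure_integrable_cst D c measurableT).
by apply: filterS Dfull => S rS; exact: (projS_quad_le mu0 HC rS).
Qed.

End MeanProjection.

(** * Convergence rate *)

Section ProcessLaw.
Context {R : realType} {d : nat} {dO : measure_display} {Omega : measurableType dO}
  {f : 'cV[R]_d -> R} {D : probability (sketch R d) R} {x0 : 'cV[R]_d}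
  {P : probability Omega R} {S : nat -> Omega -> sketch R d}
  {x : nat -> Omega -> 'cV[R]_d}.
Hypothesis hs : is_sscn f D x0 P S x.

Lemma sketch_ae (Q : sketch R d -> Prop) k :
  {ae D, forall A, Q A} -> {ae P, forall w, Q (S k w)}.
Proof.
move=> [N [mN N0 QN]]; exists (S k @^-1` N); split.
- by rewrite -[X in measurable X]setTI; exact: (sscn_sample_meas hs).
- by rewrite (sscn_law hs).
- by move=> w /= nQ; apply: QN.
Qed.

Lemma sketch_Rintegral (F : sketch R d -> R) k : measurable_fun [set: sketch R d] F ->
  P.-integrable [set: Omega] (EFin \o (fun w => F (S k w))) ->
  \int[P]_w F (S k w) = \int[D]_A F A.
Proof.
move=> mF iF; pose Sk : {mfun Omega >-> sketch R d} :=
  HB.pack (S k) (isMeasurableFun.Build _ _ _ _ (S k) (sscn_sample_meas hs k)).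
rewrite /Rintegral; congr fine.
transitivity (\int[distribution P Sk]_A (F A)%:E)%E.
  by rewrite (integral_distribution (X := Sk))//; exact/measurable_EFinP.
by apply: eq_measure_integral => A mA _; exact: (sscn_law hs k mA).
Qed.

Lemma iterate_measurable (h : 'cV[R]_d -> R) k : continuous h ->
  measurable_fun [set: Omega] (fun w => h (x k w)).
Proof.
by move=> ch; apply: measurable_continuous_comp => // j; exact: (sscn_iter_meas hs).
Qed.

Lemma iterate_past (h : 'cV[R]_d -> R) k (B : set R) : continuous h -> measurable B ->
  past S x k ((fun w => h (x k w)) @^-1` B).
Proof.
move=> ch mB; set G : set (set Omega) := [set E | exists (i : nat) (j : 'I_d) (B : set R),
         [/\ (i <= k)%N, measurable B & E = [set w | B (x i w j 0)]]] `|`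
      [set E | exists (i : nat) (B : set (sketch R d)),
         [/\ (i < k)%N, measurable B & E = S i @^-1` B]].
(* Belonging to the past becomes ordinary measurability once [Omega] carries the sigma-algebra
   generated by [G]. *)
have mX j : measurable_fun [set: g_sigma_algebraType G] (fun w => x k w j 0).
  move=> _ A mA; rewrite setTI; apply: sub_sigma_algebra; left.
  by exists k, j, A.
have := measurable_continuous_comp mX ch.
by move=> /(_ measurableT B mB); rewrite setTI.
Qed.

Lemma iterate_sketch_Rintegral (h : 'cV[R]_d -> R) (F : sketch R d -> R) k :
  continuous h -> measurable_fun [set: sketch R d] F ->
  P.-integrable [set: Omega] (EFin \o (fun w => h (x k w))) ->
  P.-integrable [set: Omega] (EFin \o (fun w => F (S k w))) ->
  P.-integrable [set: Omega] (EFin \o (fun w => h (x k w) * F (S k w))) ->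
  \int[P]_w (h (x k w) * F (S k w)) = \int[P]_w h (x k w) * \int[D]_A F A.
Proof.
move=> ch mF ih iF ihF; rewrite -(sketch_Rintegral mF iF) /Rintegral.
rewrite -fineM; [|exact: integrable_fin_num..].
congr fine; apply: integral_indep => //; first exact: iterate_measurable.
  exact: measurableT_comp mF (sscn_sample_meas hs k).
move=> A B mA mB; apply: (sscn_indep hs (k := k) (B := F @^-1` B)).
  exact: iterate_past.
by rewrite -[X in measurable X]setTI; exact: mF.
Qed.

End ProcessLaw.

Section Rate.
Context {R : realType} {d : nat} {f : 'cV[R]_d -> R} {M mu : R} {xs : 'cV[R]_d}
  {D : probability (sketch R d) R}.
Hypotheses (d0 : (0 < d)%N) (f3 : thrice_differentiable f) (M0 : 0 <= M)
  (fL : lipschitz_hess M f) (mu0 : 0 < mu) (fS : strongly_convex mu f)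
  (fmin : minimizer f xs) (Dfull : {ae D, forall S, full_col_rank S}).
Context {dO : measure_display} {Omega : measurableType dO} {x0 : 'cV[R]_d}
  {P : probability Omega R} {S : nat -> Omega -> sketch R d}
  {x : nat -> Omega -> 'cV[R]_d}.
Hypothesis hs : is_sscn f D x0 P S x.

Let H := hess f xs.
Let Q := Eproj D H.

Lemma zeta_bounds : 0 <= zeta D H <= 1.
Proof.
rewrite (zeta_ge0 mu0 (fS xs) (Eproj_sym (fS xs)) (Eproj_quad_ge0 mu0 (fS xs) Dfull)).
exact: zeta_le1 mu0 (fS xs) _ (Eproj_sym (fS xs)) (Eproj_quad_le mu0 (fS xs) Dfull) d0.
Qed.

Lemma iterates_decr k : {ae P, forall w, f (x k w) <= f x0}.
Proof.
elim: k => [|k IH]; first by apply: aeW => w; rewrite (sscn_start hs).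
apply: filterS2 IH (sscn_iter hs k) => w fk step.
exact: le_trans (sscn_step_decr f3 M0 fL step) fk.
Qed.

Lemma continuous_obj : continuous f.
Proof. by move=> y; have [df _ _] := f3 y; exact: differentiable_continuous. Qed.

Lemma continuous_grad_coord i : continuous (fun y => grad f y i 0).
Proof. by move=> y; apply/differentiable_continuous/differentiable_grad_coord. Qed.

Lemma gap_integrable k :
  P.-integrable [set: Omega] (EFin \o (fun w => f (x k w) - f xs)).
Proof.
apply: (@ae_bounded_integrable _ _ _ _ _ (f x0 - f xs)).
  apply: measurable_funB; first exact: (iterate_measurable hs k continuous_obj).
  exact: measurable_cst.
apply: filterS (iterates_decr k) => w fk.
by rewrite ger0_norm ?subr_ge0 ?fmin// lerD2r.
Qed.

Let Y k i j w := grad f (x k w) i 0 * grad f (x k w) j 0.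

Let Y_bounded : exists2 c, 0 <= c & forall k i j, {ae P, forall w, `|Y k i j w| <= c}.
Proof.
have [G hG] := grad_bounded f3 M0 fL mu0 fS fmin (f x0 - f xs).
exists (G * G); first by rewrite -expr2 sqr_ge0.
move=> k i j; apply: filterS (iterates_decr k) => w fk.
have {}hG : enorm (grad f (x k w)) <= G by apply: hG; rewrite lerD2r.
by rewrite normrM ler_pM// (le_trans (coord_le_enorm _ _)).
Qed.

Let Y_continuous i j : continuous (fun y => grad f y i 0 * grad f y j 0).
Proof. by move=> y; apply: continuousM; exact: continuous_grad_coord. Qed.

Let Y_integrable k i j : P.-integrable [set: Omega] (EFin \o Y k i j).
Proof.
have [c _ hc] := Y_bounded.
apply: (@ae_bounded_integrable _ _ _ _ _ c) (hc k i j).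
exact: (iterate_measurable hs k (@Y_continuous i j)).
Qed.

Let Z_measurable k i j :
  measurable_fun [set: Omega] (fun w => proj_term H (S k w) i j).
Proof. exact: measurableT_comp (measurable_proj_term H i j) (sscn_sample_meas hs k). Qed.

Let Z_bounded k i j : {ae P, forall w, `|proj_term H (S k w) i j| <= mu^-1}.
Proof. exact: (sketch_ae hs k (proj_term_ae_bounded mu0 (fS xs) Dfull i j)). Qed.

Let YZ_integrable k i j :
  P.-integrable [set: Omega] (EFin \o (fun w => Y k i j w * proj_term H (S k w) i j)).
Proof.
have [c c0 hc] := Y_bounded.
apply: (@ae_bounded_integrable _ _ _ _ _ (c * mu^-1)).
  by apply: measurable_funM => //; exact: (iterate_measurable hs k (@Y_continuous i j)).
by apply: filterS2 (hc k i j) (Z_bounded k i j) => w *; rewrite normrM ler_pM.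
Qed.

Let quadE (A : 'M[R]_d) k w : dotv (A *m grad f (x k w)) (grad f (x k w)) =
  \sum_i \sum_j Y k i j w * A i j.
Proof.
by rewrite dotv_quadE; apply: eq_bigr => i _; apply: eq_bigr => j _; rewrite mulrC.
Qed.

Lemma proj_gain_integrable k : P.-integrable [set: Omega]
  (EFin \o (fun w => dotv (proj_term H (S k w) *m grad f (x k w)) (grad f (x k w)))).
Proof.
under eq_fun do rewrite quadE.
by apply: integ_sum => i; apply: integ_sum => j; exact: YZ_integrable.
Qed.

Let YQ_integrable k i j :
  P.-integrable [set: Omega] (EFin \o (fun w => Y k i j w * Q i j)).
Proof.
have := integrableZr measurableT (Q i j) (Y_integrable k i j).
by apply: eq_integrable.
Qed.

Lemma mean_gain_integrable k : P.-integrable [set: Omega]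
  (EFin \o (fun w => dotv (Q *m grad f (x k w)) (grad f (x k w)))).
Proof.
under eq_fun do rewrite quadE.
by apply: integ_sum => i; apply: integ_sum => j; exact: YQ_integrable.
Qed.

(* The sampled matrix is independent of the current iterate, so that in the
   mean the projection may be replaced by its expectation. *)
Lemma Rintegral_proj_gain k :
  \int[P]_w dotv (proj_term H (S k w) *m grad f (x k w)) (grad f (x k w)) =
  \int[P]_w dotv (Q *m grad f (x k w)) (grad f (x k w)).
Proof.
under eq_Rintegral do rewrite quadE.
under [RHS]eq_Rintegral do rewrite quadE.
rewrite !Rintegral_sum => [|i|i]; [|by apply: integ_sum..].
apply: eq_bigr => i _; rewrite !Rintegral_sum//; apply: eq_bigr => j _.
rewrite (iterate_sketch_Rintegral hs (@Y_continuous i j) (measurable_proj_term H i j))//.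
  by rewrite RintegralZr// /Q EprojE.
- exact: Y_integrable.
- exact: ae_bounded_integrable (Z_measurable k i j) (Z_bounded k i j).
- exact: YZ_integrable.
Qed.

Context {del a b th : R}.
Hypotheses (ld : local_descent f xs del a b) (fx0 : f x0 - f xs <= del)
  (thab : th <= a * b) (th1 : th <= 1).

Lemma expected_gap_step k :
  \int[P]_w (f (x k.+1 w) - f xs) <=
  (1 - th * zeta D H) * \int[P]_w (f (x k w) - f xs).
Proof.
have [a0 b0 hdesc hdom] := ld.
have /andP[z0 z1] := zeta_bounds.
apply: (@le_trans _ _ (\int[P]_w (f (x k w) - f xs + (- (2^-1 * a)) *
    dotv (proj_term H (S k w) *m grad f (x k w)) (grad f (x k w))))).
  apply: ae_le_Rintegral; first exact: gap_integrable.
    by apply: integ_lin; [exact: gap_integrable|exact: proj_gain_integrable].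
  (* Almost surely the iterate is still in the sublevel set of [x0], the sample has full rank and
     the step is valid. *)
  apply: filterS3 (iterates_decr k) (sketch_ae hs k Dfull) (sscn_iter hs k) => w fk rS step.
  rewrite addrAC lerD2r mulNr; apply: (hdesc _ _ _ _ _ rS step).
  by rewrite (le_trans _ fx0)// lerD2r.
rewrite Rintegral_lin; [|exact: gap_integrable|exact: proj_gain_integrable].
rewrite Rintegral_proj_gain -Rintegral_lin; [|exact: gap_integrable|exact: mean_gain_integrable].
rewrite -RintegralZl//; last exact: gap_integrable.
apply: ae_le_Rintegral.
- by apply: integ_lin; [exact: gap_integrable|exact: mean_gain_integrable].
- have := integrableZl measurableT (1 - th * zeta D H) (gap_integrable k).
  by apply: eq_integrable.
apply: filterS (iterates_decr k) => w fk.
have /hdom hd : f (x k w) - f xs <= del by rewrite (le_trans _ fx0)// lerD2r.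
set g := grad f (x k w) in hd *.
have hq : zeta D H * dotv (invmx H *m g) g <= dotv (Q *m g) g.
  exact: (zeta_quad_le mu0 (fS xs) (Eproj_sym (fS xs)) g).
have e0 : 0 <= f (x k w) - f xs by rewrite subr_ge0.
move: hd e0 z0 hq; rewrite -/H.
move: (f (x k w) - f xs) (zeta D H) (dotv (invmx H *m _) _) (dotv (Q *m _) _).
(* [e] is the gap, [h] and [q] are the forms of [invmx H] and [Q] at the gradient. The chain is th z
   e <= a b z e <= a z h / 2 <= a q / 2. *)
move=> e z h q hd e0 z0 hq {g}.
rewrite mulrBl mul1r lerD2l mulNr lerN2.
apply: (@le_trans _ _ (a * b * z * e)).
  by rewrite ler_wpM2r// ler_wpM2r.
have -> : a * b * z * e = a * z * (b * e) by ring.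
apply: (@le_trans _ _ (a * z * (2^-1 * h))).
  by rewrite ler_wpM2l// mulr_ge0.
have -> : a * z * (2^-1 * h) = 2^-1 * a * (z * h) by ring.
by rewrite ler_wpM2l// mulr_ge0.
Qed.

Lemma expected_gap_le k :
  ('E_P[fun w => (f (x k w) - f xs)%R] <= ((1 - th * zeta D H) ^+ k * (f x0 - f xs))%:E)%E.
Proof.
have /andP[z0 z1] := zeta_bounds.
rewrite unlock -[leLHS]fineK; last exact: integrable_fin_num (gap_integrable k).
rewrite lee_fin -/(Rintegral _ _ _).
have q0 : 0 <= 1 - th * zeta D H.
  rewrite subr_ge0 (le_trans (ler_wpM2r z0 th1))// mul1r.
  exact: z1.
elim: k => [|k IH].
  rewrite expr0 mul1r; under eq_Rintegral do rewrite (sscn_start hs).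
  by rewrite Rintegral_probability_cst.
apply: (le_trans (expected_gap_step k)).
by rewrite exprS -mulrA ler_wpM2l.
Qed.

End Rate.

(** From [1 - q <= expR (- q)], raised to the power [k]. *)
Lemma contraction_pow_le (R : realType) (q e : R) k : 0 < q <= 1 -> 0 < e < 1 ->
  q^-1 * ln e^-1 <= k%:R -> (1 - q) ^+ k <= e.
Proof.
move=> /andP[q0 q1] /andP[e0 e1] hk.
apply: (@le_trans _ _ (expR (- q) ^+ k)).
  by rewrite lerXn2r ?nnegrE ?subr_ge0 ?expR_ge0// expR_ge1Dx.
rewrite -expRM_natl -[leRHS]lnK ?posrE// ler_expR.
rewrite mulrN lerNl -lnV ?posrE//.
by move: hk; rewrite mulrC ler_pdivrMr.
Qed.

Theorem theorem6p2 (R : realType) :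
  exists C : R, 0 < C /\
  forall (d : nat) (f : 'cV[R]_d -> R) (M mu : R) (xs : 'cV[R]_d)
    (D : probability (sketch R d) R),
  (0 < d)%N ->
  convex_function [set: convex_lmodType 'cV[R]_d] f ->
  thrice_differentiable f ->
  0 <= M -> lipschitz_hess M f ->
  0 < mu -> strongly_convex mu f ->
  minimizer f xs ->
  {ae D, forall S, full_col_rank S} ->
  [/\ forall eps : R, 0 < eps ->
      exists2 delta : R, 0 < delta &
      forall (dO : measure_display) (Omega : measurableType dO)
        (P : probability Omega R) (x0 : 'cV[R]_d)
        (S : nat -> Omega -> sketch R d) (x : nat -> Omega -> 'cV[R]_d),
      is_sscn f D x0 P S x ->
      f x0 - f xs <= delta ->
      forall k : nat,
      ('E_P[fun w => (f (x k w) - f xs)%R] <=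
        ((1 - (1 - eps) * zeta D (hess f xs)) ^+ k * (f x0 - f xs))%:E)%E,
      0 < zeta D (hess f xs) ->
      exists2 delta : R, 0 < delta &
      forall (dO : measure_display) (Omega : measurableType dO)
        (P : probability Omega R) (x0 : 'cV[R]_d)
        (S : nat -> Omega -> sketch R d) (x : nat -> Omega -> 'cV[R]_d),
      is_sscn f D x0 P S x ->
      f x0 - f xs <= delta ->
      forall eps' : R, 0 < eps' < 1 ->
      forall k : nat,
      C * (zeta D (hess f xs))^-1 * ln (eps'^-1) <= k%:R ->
      ('E_P[fun w => (f (x k w) - f xs)%R] <= (eps' * (f x0 - f xs))%:E)%E
    & M = 0 ->
      forall (dO : measure_display) (Omega : measurableType dO)
        (P : probability Omega R) (x0 : 'cV[R]_d)
        (S : nat -> Omega -> sketch R d) (x : nat -> Omega -> 'cV[R]_d),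
      is_sscn f D x0 P S x ->
      forall k : nat,
      ('E_P[fun w => (f (x k w) - f xs)%R] <=
        ((1 - zeta D (hess f xs)) ^+ k * (f x0 - f xs))%:E)%E].
Proof.
(* The complexity bound uses the local rate at eps = 1/2, whose factor 1 - zeta / 2 costs this
   constant 2. *)
exists 2; split=> // d f M mu xs D d0 _ f3 M0 fL mu0 fS fmin Dfull.
have /andP[z0 z1] := @zeta_bounds _ _ _ _ xs _ d0 mu0 fS Dfull.
have main (eps : R) : 0 < eps -> exists2 delta : R, 0 < delta &
    forall (dO : measure_display) (Omega : measurableType dO)
      (P : probability Omega R) (x0 : 'cV[R]_d)
      (S : nat -> Omega -> sketch R d) (x : nat -> Omega -> 'cV[R]_d),
    is_sscn f D x0 P S x -> f x0 - f xs <= delta -> forall k : nat,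
    ('E_P[fun w => (f (x k w) - f xs)%R] <=
      ((1 - (1 - eps) * zeta D (hess f xs)) ^+ k * (f x0 - f xs))%:E)%E.
  (* [eps] may exceed 1, while [local_descent_exists] covers values up to 1; the claimed factor only
     grows with [eps]. *)
  move=> e0; pose e := Num.min eps 1.
  have e01 : 0 < e <= 1 by rewrite lt_min e0 ltr01 ge_min lexx orbT.
  have [del [a [b [del0 ld ab]]]] := local_descent_exists f3 M0 fL mu0 fS fmin e01.
  have /andP[ep e1] := e01.
  exists del => // dO Omega P x0 S x hs fx0 k.
  have th1 : 1 - e <= 1 by rewrite gerBl ltW.
  apply: (le_trans (expected_gap_le d0 f3 M0 fL mu0 fS fmin Dfull hs ld fx0 ab th1 k)).
  rewrite lee_fin ler_wpM2r ?subr_ge0 ?fmin//.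
  have le_rate : 1 - (1 - e) * zeta D (hess f xs) <= 1 - (1 - eps) * zeta D (hess f xs).
    by rewrite lerD2l lerN2 ler_wpM2r// lerD2l lerN2 ge_min lexx.
  have rate0 : 0 <= 1 - (1 - e) * zeta D (hess f xs).
    rewrite subr_ge0 (le_trans _ z1)// ler_piMl//.
  by rewrite lerXn2r// nnegrE (le_trans rate0).
split=> //.
- move=> zp; have h2 : (0 : R) < 2^-1 by rewrite invr_gt0.
  have [del del0 hdel] := main _ h2; exists del => //.
  move=> dO Omega P x0 S x hs fx0 e e01 k hk.
  apply: (le_trans (hdel _ _ _ _ _ _ hs fx0 k)).
  rewrite lee_fin ler_wpM2r ?subr_ge0 ?fmin//.
  have -> : (1 - 2^-1) * zeta D (hess f xs) = 2^-1 * zeta D (hess f xs) by field.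
  apply: contraction_pow_le => //; last by rewrite invfM invrK.
  apply/andP; split; first by rewrite mulr_gt0.
  by rewrite mulr_ile1// invf_le1// ler1n.
move=> Mz dO Omega P x0 S x hs k.
(* The quadratic estimate holds at every level, so the initial gap itself serves as [del]. *)
have ld := local_descent_quadratic f3 M0 fL mu0 fS fmin (f x0 - f xs) Mz.
have ab : (1 : R) <= 1 * 1 by rewrite mulr1.
have := expected_gap_le d0 f3 M0 fL mu0 fS fmin Dfull hs ld (lexx _) ab (lexx 1) k.
by rewrite mul1r.
Qed.
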